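(* Every accessible, locally finite, quasi-transitive graph is tangle-accessible.
   Context: A graph is quasi-transitive if its automorphism group has only finitely many orbits on its vertex set. A separation of a graph $G$ is an unordered pair $\{A,B\}$ with $A\cup B=V(G)$ and no edge between $A\setminus B$ and $B\setminus A$; its order is $|A\cap B|$; its orientations are $(A,B)$ and $(B,A)$. Ends: an end is an equivalence class of rays, two rays being equivalent if for every finite vertex set $X$ they have tails in the same component of $G-X$. A finite-order separation $\{A,B\}$ distinguishes two ends if rays of one have tails in $G[A]$ and rays of the other have tails in $G[B]$. $G$ is accessible if there is $K\in\mathbb{N}$ such that every two ends of $G$ are distinguished by a separation of order at most $K$. Tangles: for $k\in\mathbb{N}\cup\{\aleph_0\}$ let $S_k$ be the set of separations of order $<k$. A $k$-tangle is a set containing exactly one orientation of each element of $S_k$ such that for any three (not necessarily distinct) members $(A_1,B_1),(A_2,B_2),(A_3,B_3)$ we have $G[A_1]\cup G[A_2]\cup G[A_3]\ne G$; a tangle is a $k$-tangle for some $k$. A separation distinguishes two tangles if they contain different orientations of it; two tangles are distinguishable if some separation distinguishes them. $G$ is tangle-accessible if there is $K\in\mathbb{N}$ such that every two distinguishable tangles of $G$ are distinguished by a separation of order at most $K$. *)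

(* Defs.v *)
(* a (possibly infinite) simple graph is a type V of vertices
   with a symmetric irreflexive adjacency relation adj : V -> V -> Prop.
   Vertex sets are predicates V -> Prop; finite vertex sets are lists. *)
From Stdlib Require Import List Arith.
Import ListNotations.

Section Graphs.
Variables (V : Type) (adj : V -> V -> Prop).

Definition simple_graph : Prop :=
  (forall u v, adj u v -> adj v u) /\ (forall v, ~ adj v v).

Definition locally_finite : Prop :=
  forall v, exists l : list V, forall u, adj v u -> In u l.

Definition automorphism (f : V -> V) : Prop :=
  (exists g : V -> V, (forall x, g (f x) = x) /\ (forall y, f (g y) = y)) /\
  (forall x y, adj x y <-> adj (f x) (f y)).

Definition quasi_transitive : Prop :=
  exists reps : list V, forall v, exists r, In r reps /\
    exists f, automorphism f /\ f r = v.

Definition set_eq (A B : V -> Prop) : Prop := forall x, A x <-> B x.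

Definition separation (A B : V -> Prop) : Prop :=
  (forall v, A v \/ B v) /\
  (forall u v, adj u v -> A u -> ~ B u -> B v -> ~ A v -> False).

Definition order_le (A B : V -> Prop) (n : nat) : Prop :=
  exists l : list V, length l <= n /\ forall x, A x -> B x -> In x l.

Definition finite_order (A B : V -> Prop) : Prop :=
  exists l : list V, forall x, A x -> B x -> In x l.

(* k ∈ ℕ ∪ {ℵ0}: Some n = n, None = ℵ0 *)
Definition order_lt (A B : V -> Prop) (k : option nat) : Prop :=
  match k with
  | Some n => exists m, m < n /\ order_le A B m
  | None => finite_order A B
  end.

Definition in_S (k : option nat) (A B : V -> Prop) : Prop :=
  separation A B /\ order_lt A B k.

Inductive reach (P : V -> Prop) : V -> V -> Prop :=
| reach_refl : forall u, P u -> reach P u u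
| reach_step : forall u w v, P u -> adj u w -> reach P w v -> reach P u v.

Definition ray (r : nat -> V) : Prop :=
  (forall m n, r m = r n -> m = n) /\ (forall n, adj (r n) (r (S n))).

Definition tail_in (r : nat -> V) (A : V -> Prop) : Prop :=
  exists m, forall n, m <= n -> A (r n).

Definition equiv_rays (r1 r2 : nat -> V) : Prop :=
  forall X : list V, exists m, forall n1 n2, m <= n1 -> m <= n2 ->
    reach (fun x => ~ In x X) (r1 n1) (r2 n2).

Definition end_in (r : nat -> V) (A : V -> Prop) : Prop :=
  forall r', ray r' -> equiv_rays r r' -> tail_in r' A.

Definition accessible : Prop :=
  exists K : nat, forall r1 r2, ray r1 -> ray r2 -> ~ equiv_rays r1 r2 ->
    exists A B, separation A B /\ order_le A B K /\
      end_in r1 A /\ end_in r2 B.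

(* a set of oriented separations, given as a predicate on pairs of vertex
   sets; it is required to respect extensional equality of vertex sets *)
Definition orient_set := (V -> Prop) -> (V -> Prop) -> Prop.

Definition covers3 (A1 A2 A3 : V -> Prop) : Prop :=
  (forall v, A1 v \/ A2 v \/ A3 v) /\
  (forall u v, adj u v ->
     (A1 u /\ A1 v) \/ (A2 u /\ A2 v) \/ (A3 u /\ A3 v)).

Definition k_tangle (k : option nat) (tau : orient_set) : Prop :=
  (* tau is a set: closed under equality of vertex sets *)
  (forall A B A' B', set_eq A A' -> set_eq B B' -> tau A B -> tau A' B') /\
  (forall A B, tau A B -> in_S k A B) /\
  (forall A B, in_S k A B -> tau A B \/ tau B A) /\
  (forall A B, tau A B -> tau B A -> set_eq A B) /\
  (forall A1 B1 A2 B2 A3 B3, tau A1 B1 -> tau A2 B2 -> tau A3 B3 ->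
     ~ covers3 A1 A2 A3).

Definition tangle (tau : orient_set) : Prop := exists k, k_tangle k tau.

Definition distinguishes (A B : V -> Prop) (tau1 tau2 : orient_set) : Prop :=
  separation A B /\ ~ set_eq A B /\ tau1 A B /\ tau2 B A.

Definition distinguishable (tau1 tau2 : orient_set) : Prop :=
  exists A B, distinguishes A B tau1 tau2.

Definition tangle_accessible : Prop :=
  exists K : nat, forall tau1 tau2, tangle tau1 -> tangle tau2 ->
    distinguishable tau1 tau2 ->
    exists A B, order_le A B K /\ distinguishes A B tau1 tau2.

End Graphs.

Arguments simple_graph {V}.
Arguments accessible {V}.
Arguments locally_finite {V}.
Arguments quasi_transitive {V}.
Arguments tangle_accessible {V}.

(* Main.v *)
(* If two tangles of large order are distinguished only by separations of large
   order, look at the ends.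

   Ends.  For a tangle tau and an end omega whose least distinguishing order is n,
   take (A, B) of order n with tau in A, omega in B and A minimal.  When n > K,
   where K bounds the orders needed to separate ends, submodularity makes all such
   minimal (A, B) with the same omega pairwise nested, and (A, B) is equal to or
   disjoint from each of its translates under Stab(omega).  The pairs (w, omega)
   with w in the boundary of such an (A, B) form finitely many orbits: an efficient
   separation of two ends omega, omega' can be uncrossed so that w lies in its
   separator, and only finitely many tight separators of order at most K contain w.
   So if n were unbounded, there would be minimal (A1, B1), (A2, B2) of orders
   n1 < n2 with the same omega, sharing a boundary vertex and an inner vertex, and
   with the same orbits of boundary vertices inside.  Then A1 is contained in A2 and
   its boundary in that of A2; as the inside of A2 is connected, n1 = n2.

   No ends.  If every end is separated from tau by order at most b, let a be the
   largest order needed.  Take (A, B) of order a between tau and an end, A minimal.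
   Any two tangles with the same minimal (A, B) agree on all separations of order at
   most a, and by compactness finitely many of these leave only a finite set, which
   bounds the order of all these tangles.  There are finitely many (A, B) up to
   automorphism. *)
From Stdlib Require Import List Arith Lia FinFun Classical ClassicalEpsilon.
From Stdlib Require Import FunctionalExtensionality PropExtensionality.
Require Import Defs.
Import ListNotations.

(** * Finite lists, choice and minimal elements in classical logic *)

Definition dec (P : Prop) : bool :=
  if excluded_middle_informative P then true else false.

Lemma decP (P : Prop) : dec P = true <-> P.
Proof. unfold dec; destruct excluded_middle_informative; split; intuition congruence. Qed.

Lemma length_filter_dec (T : Type) (P : T -> Prop) (l : list T) :
  length (filter (fun x => dec (P x)) l) + length (filter (fun x => dec (~ P x)) l) = length l.
Proof.
  induction l as [|x l IH]; simpl; auto.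
  unfold dec in *.
  destruct (excluded_middle_informative (P x)), (excluded_middle_informative (~ P x));
    simpl; try tauto; rewrite <- IH; lia.
Qed.

Lemma in_filter_dec (T : Type) (P : T -> Prop) (l : list T) x :
  In x (filter (fun x => dec (P x)) l) <-> In x l /\ P x.
Proof. rewrite filter_In, decP; tauto. Qed.

Lemma least_nat (P : nat -> Prop) :
  (exists n, P n) -> exists n, P n /\ forall m, P m -> n <= m.
Proof.
  intros [n Hn]. revert Hn. induction n as [n IH] using lt_wf_ind; intros Hn.
  destruct (classic (exists m, m < n /\ P m)) as [[m [Hm Pm]]|H]; [eauto|].
  exists n; split; auto. intros m Pm.
  destruct (le_lt_dec n m); auto. exfalso; eauto.
Qed.

Lemma greatest_nat (P : nat -> Prop) b :
  (exists n, P n) -> (forall n, P n -> n <= b) -> exists n, P n /\ forall m, P m -> m <= n.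
Proof.
  intros [n Hn] Hb.
  destruct (least_nat (fun d => exists m, P m /\ m + d = b)) as (d & (m & Pm & Hd) & Hmin).
  { exists (b - n), n. split; auto. specialize (Hb n Hn); lia. }
  exists m; split; auto. intros m' Pm'.
  assert (d <= b - m'). { apply Hmin. exists m'. split; auto. specialize (Hb m' Pm'); lia. }
  specialize (Hb m' Pm'); lia.
Qed.

Lemma list_choice (S T : Type) (l : list S) (P : S -> T -> Prop) :
  (forall s, In s l -> exists L : list T, forall t, P s t -> In t L) ->
  exists L : list T, forall s t, In s l -> P s t -> In t L.
Proof.
  induction l as [|s l IH]; intros H.
  - exists []. simpl; tauto.
  - destruct IH as [L HL]. { intros; apply H; simpl; auto. }
    destruct (H s) as [L' HL']; [simpl; auto|].
    exists (L' ++ L). intros s' t [->|Hs] Ht; apply in_or_app; eauto.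
Qed.

Lemma list_bound (S : Type) (l : list S) (P : S -> nat -> Prop) :
  (forall s m n, m <= n -> P s m -> P s n) ->
  (forall s, In s l -> exists n, P s n) -> exists n, forall s, In s l -> P s n.
Proof.
  intros Hmono. induction l as [|s l IH]; intros H.
  - exists 0. simpl; tauto.
  - destruct IH as [n Hn]. { intros; apply H; simpl; auto. }
    destruct (H s) as [m Hm]; [simpl; auto|].
    exists (m + n). intros s' [<-|Hs].
    + apply Hmono with m; auto; lia.
    + apply Hmono with n; auto; lia.
Qed.

Lemma finite_minimal (T : Type) (R : T -> T -> Prop) (L : list T) :
  (forall x y z, R x y -> R y z -> R x z) -> (forall x, R x x) ->
  forall P : T -> Prop, (forall x, P x -> In x L) -> (exists x, P x) ->
  exists x, P x /\ forall y, P y -> R y x -> R x y.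
Proof.
  intros Htr Hrefl. remember (length L) as n eqn:Hn. revert L Hn.
  induction n as [n IH] using lt_wf_ind; intros L -> P HL [x Px].
  destruct (classic (exists y, P y /\ R y x /\ ~ R x y)) as [(y & Py & Ryx & Nxy)|H].
  - destruct (IH (length (filter (fun z => dec (R z y)) L))) with
      (L := filter (fun z => dec (R z y)) L) (P := fun z => P z /\ R z y)
      as (z & [Pz Rzy] & Hz); auto.
    + assert (H := length_filter_dec T (fun z => R z y) L).
      assert (Hx : In x (filter (fun z => dec (~ R z y)) L)).
      { apply in_filter_dec; split; auto. }
      destruct (filter (fun z => dec (~ R z y)) L); simpl in *; [tauto|lia].
    + intros z [Pz Rz]. apply in_filter_dec; auto.
    + exists y; auto.
    + exists z; split; auto. intros w Pw Rwz. apply Hz; eauto.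
  - exists x; split; auto. intros y Py Ryx. apply NNPP; intros N; apply H; eauto.
Qed.

Lemma finite_classes (T : Type) (R : T -> T -> Prop) (ps : list (T -> Prop)) :
  forall P : T -> Prop,
  (forall x y, P x -> P y -> (forall p, In p ps -> (p x <-> p y)) -> R x y) ->
  exists L : list T, (forall x, In x L -> P x) /\ forall x, P x -> exists y, In y L /\ R y x.
Proof.
  induction ps as [|p ps IH]; intros P H.
  - destruct (classic (exists x, P x)) as [[x Px]|N].
    + exists [x]. split; [intros ? [<-|[]]; auto|].
      intros y Py; exists x; split; simpl; auto. apply H; simpl; tauto.
    + exists []. split; [simpl; tauto|]. intros x Px; exfalso; eauto.
  - destruct (IH (fun x => P x /\ p x)) as (L1 & H1 & H1').
    { intros x y [Px px] [Py py] E. apply H; auto. intros q [<-|Hq]; [tauto|auto]. }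
    destruct (IH (fun x => P x /\ ~ p x)) as (L2 & H2 & H2').
    { intros x y [Px px] [Py py] E. apply H; auto. intros q [<-|Hq]; [tauto|auto]. }
    exists (L1 ++ L2). split.
    + intros x Hx; apply in_app_or in Hx as [Hx|Hx]; [apply H1 in Hx|apply H2 in Hx]; tauto.
    + intros x Px. destruct (classic (p x)) as [px|px].
      * destruct (H1' x) as (y & Hy & Ry); auto. exists y; split; auto. apply in_or_app; auto.
      * destruct (H2' x) as (y & Hy & Ry); auto. exists y; split; auto. apply in_or_app; auto.
Qed.

(** Plays the part of an infinite subsequence: it survives on some piece of every finite partition,
    so finitely many parameters can be fixed one after another. *)
Definition unbounded (T : Type) (f : T -> nat) (P : T -> Prop) : Prop :=
  forall N, exists t, P t /\ N < f t.

Lemma unbounded_split (T : Type) (f : T -> nat) (P Q : T -> Prop) :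
  unbounded T f P ->
  unbounded T f (fun t => P t /\ Q t) \/ unbounded T f (fun t => P t /\ ~ Q t).
Proof.
  intros H. destruct (classic (unbounded T f (fun t => P t /\ Q t))) as [|N]; auto.
  right. intros n. apply not_all_ex_not in N as [m Hm].
  destruct (H (m + n)) as (t & Pt & Ht). exists t. split; [split; auto|lia].
  intros Qt. apply Hm. exists t. split; auto; lia.
Qed.

Lemma unbounded_pick (T S : Type) (f : T -> nat) (P : T -> Prop) (l : list S)
  (Q : S -> T -> Prop) :
  unbounded T f P -> (forall t, P t -> exists s, In s l /\ Q s t) ->
  exists s, In s l /\ unbounded T f (fun t => P t /\ Q s t).
Proof.
  revert P. induction l as [|s l IH]; intros P HP H.
  - destruct (HP 0) as (t & Pt & _). destruct (H t Pt) as (s & [] & _).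
  - destruct (unbounded_split T f P (Q s) HP) as [U|U]; [exists s; simpl; auto|].
    destruct (IH (fun t => P t /\ ~ Q s t)) as (s' & Hs & U'); auto.
    + intros t [Pt Nt]. destruct (H t Pt) as (s' & [<-|Hs] & Qs); [tauto|eauto].
    + exists s'; split; simpl; auto. intros N. destruct (U' N) as (t & Ht & ?).
      exists t; tauto.
Qed.

Lemma unbounded_uniform (T : Type) (f : T -> nat) (ps : list (T -> Prop)) :
  forall P : T -> Prop, unbounded T f P ->
  exists P' : T -> Prop, unbounded T f P' /\ (forall t, P' t -> P t) /\
    forall p t u, In p ps -> P' t -> P' u -> p t -> p u.
Proof.
  induction ps as [|p ps IH]; intros P HP.
  - exists P; simpl; tauto.
  - destruct (unbounded_split T f P p HP) as [U|U];
      destruct (IH _ U) as (P' & U' & HP' & H'); exists P'; (split; [auto|split]).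
    + intros t Ht; apply HP'; auto.
    + intros q t u [<-|Hq] Ht Hu; [intros _; apply HP'; auto|apply (H' q t u); auto].
    + intros t Ht; apply HP'; auto.
    + intros q t u [<-|Hq] Ht Hu; [|apply (H' q t u); auto]. intros X. exfalso. apply HP' in Ht. tauto.
Qed.

Lemma pigeonhole_nat (T : Type) (f : nat -> T) (L : list T) :
  (forall i, In (f i) L) -> exists i j, i < j /\ f i = f j.
Proof.
  intros H. apply NNPP; intros N.
  assert (E : forall i j, f i = f j -> i = j).
  { intros i j Hij. destruct (lt_eq_lt_dec i j) as [[?|?]|?]; auto; exfalso; apply N; eauto. }
  assert (ND : NoDup (map f (seq 0 (S (length L))))).
  { apply Injective_map_NoDup; [exact E|apply seq_NoDup]. }
  apply NoDup_incl_length with (l' := L) in ND.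
  - rewrite length_map, length_seq in ND; lia.
  - intros x Hx. apply in_map_iff in Hx as (i & <- & _); auto.
Qed.

Section Graph.
Variables (V : Type) (adj : V -> V -> Prop).
Hypothesis adj_sym : forall u v, adj u v -> adj v u.

Notation vset := (V -> Prop).
Notation sep := (separation V adj).
Notation ord := (order_le V).
Notation reach := (reach V adj).

Definition co (A : vset) : vset := fun x => ~ A x.
Definition cup (A B : vset) : vset := fun x => A x \/ B x.
Definition cap (A B : vset) : vset := fun x => A x /\ B x.
Definition full : vset := fun _ => True.
Definition nil_set : vset := fun _ => False.
Definition sub (A B : vset) : Prop := forall x, A x -> B x.
(** The pair [(cl Q, co Q)] is the separation with inside [Q] whose boundary is the outer
    neighbourhood of [Q]. *)
Definition cl (Q : vset) : vset := fun x => Q x \/ exists y, Q y /\ adj y x.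
Definition card_le (X : vset) (n : nat) : Prop :=
  exists l : list V, length l <= n /\ forall x, X x -> In x l.

Lemma vset_ext (A B : vset) : (forall x, A x <-> B x) -> A = B.
Proof.
  intros H. apply functional_extensionality; intros x.
  apply propositional_extensionality; auto.
Qed.

Lemma sub_antisym (A B : vset) : sub A B -> sub B A -> A = B.
Proof. intros H H'; apply vset_ext; split; auto. Qed.

(** * Separations and their orders *)

Lemma sep_edge A B u v : sep A B -> adj u v -> (A u /\ A v) \/ (B u /\ B v).
Proof.
  intros [H1 H2] E. assert (E' := adj_sym _ _ E).
  assert (H3 := H2 _ _ E). assert (H4 := H2 _ _ E').
  destruct (H1 u), (H1 v); tauto.
Qed.

Lemma sep_of_edges A B : (forall v, A v \/ B v) ->
  (forall u v, adj u v -> (A u /\ A v) \/ (B u /\ B v)) -> sep A B.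
Proof. intros H H'. split; auto. intros u v E. specialize (H' u v E). tauto. Qed.

Lemma sep_sym A B : sep A B -> sep B A.
Proof.
  intros S. apply sep_of_edges.
  - intros v. destruct S as [H _]. specialize (H v); tauto.
  - intros u v E. apply (sep_edge A B u v S) in E; tauto.
Qed.

Lemma sep_cup A B C D : sep A B -> sep C D -> sep (cup A C) (cap B D).
Proof.
  intros S S'. unfold cup, cap. apply sep_of_edges.
  - intros v. destruct S as [H _], S' as [H' _]. specialize (H v); specialize (H' v); tauto.
  - intros u v E. assert (H := sep_edge A B u v S E).
    assert (H' := sep_edge C D u v S' E). tauto.
Qed.

Lemma sep_cap A B C D : sep A B -> sep C D -> sep (cap A C) (cup B D).
Proof. intros S S'. apply sep_sym, sep_cup; apply sep_sym; auto. Qed.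

Lemma sep_cl Q : sep (cl Q) (co Q).
Proof.
  unfold cl, co. apply sep_of_edges.
  - intros v. destruct (classic (Q v)); auto.
  - intros u v E. assert (E' := adj_sym _ _ E).
    destruct (classic (Q u)), (classic (Q v)); [left|left|left|right]; split; eauto.
Qed.

Lemma sep_full A : sep A full.
Proof. unfold full; apply sep_of_edges; auto. Qed.

Lemma sep_compl_cover A B x : sep A B -> ~ A x -> B x.
Proof. intros [H _]. specialize (H x); tauto. Qed.

Lemma sep_nbr A B x y : sep A B -> A x -> ~ B x -> adj x y -> A y.
Proof. intros S Ax Bx E. apply (sep_edge A B) in E; auto. tauto. Qed.

Lemma ord_card A B n : card_le (cap A B) n -> ord A B n.
Proof. intros (l & Hl & H). exists l; split; auto. intros x Ax Bx; apply H; split; auto. Qed.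

Lemma card_ord A B n : ord A B n -> card_le (cap A B) n.
Proof. intros (l & Hl & H). exists l; split; auto. intros x [Ax Bx]; auto. Qed.

Lemma card_sub X Y n : sub X Y -> card_le Y n -> card_le X n.
Proof. intros H (l & Hl & HY). exists l; split; auto. Qed.

Lemma ord_sym A B n : ord A B n -> ord B A n.
Proof. intros (l & Hl & H). exists l; split; auto. Qed.

Lemma ord_mono A B m n : m <= n -> ord A B m -> ord A B n.
Proof. intros Hmn (l & Hl & H). exists l; split; auto; lia. Qed.

Lemma ord_fin A B n : ord A B n -> finite_order V A B.
Proof. intros (l & Hl & H). exists l; auto. Qed.

Lemma fin_ord A B : finite_order V A B -> exists n, ord A B n.
Proof. intros (l & H). exists (length l), l; auto. Qed.

Lemma fin_sym A B : finite_order V A B -> finite_order V B A.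
Proof. intros (l & H). exists l; auto. Qed.

(** Each boundary list is cut into two complementary pieces, one for each corner, so the lengths add
    up to those of the given lists. Since [ord] only bounds an order from above, suitable bounds [p]
    and [q] are part of the claim. *)
Lemma submodular A B C D a b : ord A B a -> ord C D b ->
  exists p q, p + q <= a + b /\
    ord (cup A C) (cap B D) p /\ ord (cap A C) (cup B D) q.
Proof.
  intros (l & Hl & H) (l' & Hl' & H').
  assert (E := length_filter_dec V D l). assert (E' := length_filter_dec V A l').
  exists (length (filter (fun x => dec (D x)) l ++ filter (fun x => dec (~ A x)) l')),
    (length (filter (fun x => dec (~ D x)) l ++ filter (fun x => dec (A x)) l')).
  rewrite !length_app. repeat split; [lia| |]; eexists; (split; [rewrite <- length_app; auto|]);
    unfold cup, cap; intros x Hx Hx'; rewrite in_app_iff, !in_filter_dec;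
    specialize (H x); specialize (H' x).
  - destruct (classic (A x)); tauto.
  - destruct (classic (D x)); tauto.
Qed.

(** * Reachability *)

Lemma reach_start P u v : reach P u v -> P u.
Proof. destruct 1; auto. Qed.

Lemma reach_end P u v : reach P u v -> P v.
Proof. induction 1; auto. Qed.

Lemma reach_trans P u v w : reach P u v -> reach P v w -> reach P u w.
Proof. induction 1; auto. intros; eapply reach_step; eauto. Qed.

Lemma reach_snoc P u v w : reach P u v -> adj v w -> P w -> reach P u w.
Proof.
  intros H E Pw. apply reach_trans with v; auto.
  apply reach_step with w; auto. eapply reach_end; eauto. constructor; auto.
Qed.

Lemma reach_sym P u v : reach P u v -> reach P v u.
Proof.
  induction 1 as [u Pu|u w v Pu E H IH].
  - constructor; auto.
  - apply reach_snoc with w; auto.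
Qed.

Lemma reach_mono P Q u v : sub P Q -> reach P u v -> reach Q u v.
Proof. intros S. induction 1; [constructor|eapply reach_step]; eauto. Qed.

Lemma reach_stable (P R : vset) u v :
  reach P u v -> R u -> (forall x y, P x -> P y -> R x -> adj x y -> R y) -> R v.
Proof.
  intros H Ru St. revert Ru. induction H as [|u w v Pu E H IH]; auto.
  intros Ru. apply IH. apply (St u); auto. eapply reach_start; eauto.
Qed.

Lemma reach_strengthen P u v : reach P u v -> reach (reach P u) u v.
Proof.
  intros H. assert (Pu := reach_start _ _ _ H).
  apply (reach_stable P (fun x => reach P u x /\ reach (reach P u) u x) u v) in H; [tauto| |].
  - split; constructor; auto. constructor; auto.
  - intros x y Px Py [R1 R2] E. assert (reach P u y) by (eapply reach_snoc; eauto).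
    split; auto. eapply reach_snoc; eauto.
Qed.

Lemma reach_list P u v : reach P u v ->
  exists l, (forall x, In x l -> P x) /\
    forall Q : vset, (forall x, In x l -> Q x) -> reach Q u v.
Proof.
  induction 1 as [u Pu|u w v Pu E H (l & H1 & H2)].
  - exists [u]; split; [intros ? [<-|[]]; auto|].
    intros Q HQ; constructor; apply HQ; simpl; auto.
  - exists (u :: l); split; [intros ? [<-|]; auto|].
    intros Q HQ; apply reach_step with w; auto; [apply HQ; simpl; auto|].
    apply H2; intros; apply HQ; simpl; auto.
Qed.

Lemma reach_side A B u v : sep A B -> reach (co (cap A B)) u v -> A u -> ~ B u -> A v /\ ~ B v.
Proof.
  intros S H Au Bu.
  apply (reach_stable _ (fun x => A x /\ ~ B x) _ _ H); auto.
  intros x y Px Py [Ax Bx] E. assert (A y) by (eapply sep_nbr; eauto).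
  unfold co, cap in Py. tauto.
Qed.

Definition comp (X : vset) (q : V) : vset := reach (co X) q.

Lemma comp_nbr X q x y : comp X q x -> adj x y -> ~ X y -> comp X q y.
Proof. intros; eapply reach_snoc; eauto. Qed.

Lemma comp_boundary X q : sub (cap (cl (comp X q)) (co (comp X q))) X.
Proof.
  intros x [[H|(y & Hy & E)] N]; [destruct (N H)|].
  apply NNPP; intros Xx. apply N. eapply comp_nbr; eauto.
Qed.

Lemma comp_refl X q : ~ X q -> comp X q q.
Proof. intros; constructor; auto. Qed.

Lemma comp_not X q x : comp X q x -> ~ X x.
Proof. intros H; apply reach_end in H; auto. Qed.

(** * Rays and the orientations induced by their ends *)

(* The orientation of finite-order separations towards the end of r. *)
Definition endo (r : nat -> V) (A B : vset) : Prop :=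
  sep A B /\ finite_order V A B /\ exists m, forall n, m <= n -> B (r n) /\ ~ A (r n).

Lemma endo_excl r A B : endo r A B -> endo r B A -> False.
Proof.
  intros (_ & _ & m & Hm) (_ & _ & m' & Hm').
  specialize (Hm (m + m')); specialize (Hm' (m + m')).
  destruct Hm, Hm'; try lia; auto.
Qed.

Lemma ray_leaves r (l : list V) : ray V adj r -> exists m, forall n, m <= n -> ~ In (r n) l.
Proof.
  intros [Hinj _]. induction l as [|x l [m Hm]].
  - exists 0; auto.
  - destruct (classic (exists i, r i = x)) as [[i Hi]|N].
    + exists (m + S i). intros n Hn [E|Hin].
      * rewrite E in Hi. apply Hinj in Hi. lia.
      * apply (Hm n); auto; lia.
    + exists m. intros n Hn [E|Hin]; [eauto|apply (Hm n); auto].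
Qed.

Lemma ray_reach r (P : vset) m : ray V adj r -> (forall n, m <= n -> P (r n)) ->
  forall n, m <= n -> reach P (r m) (r n).
Proof.
  intros [_ Hr] HP. induction n as [|n IH]; intros Hn.
  - replace m with 0 by lia. constructor. apply HP; lia.
  - destruct (le_lt_dec m n).
    + apply reach_snoc with (r n); auto.
    + replace (S n) with m by lia. constructor. auto.
Qed.

Lemma endo_total r A B : ray V adj r -> sep A B -> finite_order V A B ->
  endo r A B \/ endo r B A.
Proof.
  intros Hr S [l Hl]. destruct (ray_leaves r l Hr) as [m Hm].
  assert (HP : forall n, m <= n -> co (cap A B) (r n)).
  { intros n Hn [Ax Bx]. apply (Hm n); auto. }
  assert (R := ray_reach r _ m Hr HP).
  destruct (classic (A (r m))) as [Am|Am].
  - right. split; [apply sep_sym; auto|split; [apply fin_sym; exists l; auto|]].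
    exists m. intros n Hn. apply (reach_side A B (r m)); auto.
    specialize (HP m (le_n m)). unfold co, cap in HP; tauto.
  - left. split; [auto|split; [exists l; auto|]].
    exists m. intros n Hn. apply (reach_side B A (r m)); auto.
    + apply sep_sym; auto.
    + eapply reach_mono; [|apply R; auto]. unfold co, cap; intros x; tauto.
    + eapply sep_compl_cover; eauto.
Qed.

Lemma endo_cup r A B C D : endo r A B -> endo r C D -> endo r (cup A C) (cap B D).
Proof.
  intros (S & F & m & Hm) (S' & F' & m' & Hm').
  split; [apply sep_cup; auto|split].
  - destruct (fin_ord _ _ F) as [a Ha], (fin_ord _ _ F') as [b Hb].
    destruct (submodular _ _ _ _ _ _ Ha Hb) as (p & q & _ & H & _).
    eapply ord_fin; eauto.
  - exists (m + m'). intros n Hn.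
    destruct (Hm n), (Hm' n); try lia. unfold cup, cap; tauto.
Qed.

Lemma endo_cap r A B C D : endo r A B -> sep C D -> finite_order V C D ->
  endo r (cap A C) (cup B D).
Proof.
  intros (S & F & m & Hm) S' F'.
  split; [apply sep_cap; auto|split].
  - destruct (fin_ord _ _ F) as [a Ha], (fin_ord _ _ F') as [b Hb].
    destruct (submodular _ _ _ _ _ _ Ha Hb) as (p & q & _ & _ & H).
    eapply ord_fin; eauto.
  - exists m. intros n Hn. destruct (Hm n); auto. unfold cup, cap; tauto.
Qed.

Lemma endo_mono r A B C D : endo r A B -> sep C D -> finite_order V C D ->
  sub C A -> endo r C D.
Proof.
  intros (S & F & m & Hm) S' F' H. split; [auto|split; auto].
  exists m. intros n Hn. destruct (Hm n) as [_ N]; auto.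
  assert (~ C (r n)) by (intros X; apply N, H, X). split; auto.
  eapply sep_compl_cover; eauto.
Qed.

Lemma tail_endo r A B : ray V adj r -> sep A B -> finite_order V A B ->
  tail_in V r B -> endo r A B.
Proof.
  intros Hr S F [m Hm]. destruct (endo_total r A B Hr S F) as [|(_ & _ & m' & Hm')]; auto.
  exfalso. apply (Hm' (m + m')); [lia|]. apply Hm; lia.
Qed.

(** Ends are compared only through the orientations that they induce; equivalent rays agree in this
    sense. *)
Definition end_eq (r r' : nat -> V) : Prop := forall A B, endo r A B <-> endo r' A B.

Lemma equiv_rays_end_eq r r' : ray V adj r -> ray V adj r' ->
  equiv_rays V adj r r' -> end_eq r r'.
Proof.
  assert (H : forall r r', ray V adj r -> ray V adj r' ->
    equiv_rays V adj r r' -> forall A B, endo r A B -> endo r' A B).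
  { intros r1 r2 R1 R2 E A B H. destruct (endo_total r2 A B) as [|H']; auto; try apply H.
    exfalso. destruct H as (S & [l Hl] & m & Hm), H' as (_ & _ & m' & Hm').
    destruct (E l) as [k Hk]. specialize (Hk (k + m + m') (k + m + m')).
    destruct (Hm (k + m + m')); [lia|]. destruct (Hm' (k + m + m')); [lia|].
    apply (reach_mono _ (co (cap B A))) in Hk; try lia.
    - apply (reach_side B A _ _ (sep_sym _ _ S)) in Hk; tauto.
    - intros x Hx [? ?]. apply Hx; auto. }
  intros R R' E A B. split; [apply H; auto|apply H; auto].
  intros X. destruct (E X) as [m Hm]. exists m. intros. apply reach_sym; auto.
Qed.

Lemma equiv_rays_refl r : ray V adj r -> equiv_rays V adj r r.
Proof.
  intros Hr X. destruct (ray_leaves r X Hr) as [m Hm]. exists m.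
  intros n1 n2 H1 H2. apply reach_trans with (r m); [apply reach_sym|];
    apply ray_reach; auto.
Qed.

Lemma accessible_separates K r r' :
  (forall r1 r2, ray V adj r1 -> ray V adj r2 -> ~ equiv_rays V adj r1 r2 ->
    exists A B, sep A B /\ ord A B K /\ end_in V adj r1 A /\ end_in V adj r2 B) ->
  ray V adj r -> ray V adj r' -> ~ end_eq r r' ->
  exists A B, ord A B K /\ endo r A B /\ endo r' B A.
Proof.
  intros H R R' N. destruct (H r r') as (A & B & S & O & EA & EB); auto.
  { intros E; apply N, equiv_rays_end_eq; auto. }
  exists B, A. split; [apply ord_sym; auto|].
  assert (F := ord_fin _ _ _ O).
  split; apply tail_endo; auto using sep_sym, fin_sym.
  - apply EA; auto. apply equiv_rays_refl; auto.
  - apply EB; auto. apply equiv_rays_refl; auto.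
Qed.

(** * Tangles *)

Definition okn (k : option nat) (n : nat) : Prop :=
  match k with Some k => n < k | None => True end.

Lemma okn_le k m n : m <= n -> okn k n -> okn k m.
Proof. destruct k; simpl; auto; lia. Qed.

Lemma in_S_okn k A B n : sep A B -> ord A B n -> okn k n -> in_S V adj k A B.
Proof.
  intros S O H. split; auto. destruct k; simpl in *; [eauto|eapply ord_fin; eauto].
Qed.

Lemma okn_in_S k A B : in_S V adj k A B -> exists n, ord A B n /\ okn k n.
Proof.
  intros [S H]. destruct k; simpl in *.
  - destruct H as (m & ? & ?); eauto.
  - destruct (fin_ord _ _ H); eauto.
Qed.

Notation ktan := (k_tangle V adj).

Lemma tangle_sep k tau A B : ktan k tau -> tau A B -> sep A B.
Proof. intros (_ & T & _) H. apply T in H. apply H. Qed.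

Lemma tangle_total k tau A B n : ktan k tau -> sep A B -> ord A B n -> okn k n ->
  tau A B \/ tau B A.
Proof. intros (_ & _ & T & _) S O H. apply T. eapply in_S_okn; eauto. Qed.

Lemma tangle_no_cover2 k tau A B C D : ktan k tau -> tau A B -> tau C D ->
  (forall v, A v \/ C v) ->
  (forall u v, adj u v -> (A u /\ A v) \/ (C u /\ C v)) -> False.
Proof.
  intros T H H' C1 C2. destruct T as (_ & _ & _ & _ & T).
  apply (T A B C D C D); auto. split.
  - intros v; specialize (C1 v); tauto.
  - intros u v E; specialize (C2 u v E); tauto.
Qed.

(** The sides of a separation cover the graph. This also rules out [tau A A], which the uniqueness
    clause of a tangle alone would allow. *)
Lemma tangle_excl k tau A B : ktan k tau -> tau A B -> tau B A -> False.
Proof.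
  intros T H H'. assert (S := tangle_sep _ _ _ _ T H).
  apply (tangle_no_cover2 k tau A B B A); auto; [apply S|].
  intros; eapply sep_edge; eauto.
Qed.

Lemma tangle_not_full k tau B : ktan k tau -> tau full B -> False.
Proof.
  intros T H. apply (tangle_no_cover2 k tau full B full B); unfold full; auto.
Qed.

Lemma tangle_mono k tau A B C D n : ktan k tau -> tau A B ->
  sep C D -> ord C D n -> okn k n -> sub B D -> tau C D.
Proof.
  intros T H S O Hn HS. destruct (tangle_total k tau C D n) as [|H']; auto.
  exfalso. assert (SA := tangle_sep _ _ _ _ T H).
  apply (tangle_no_cover2 k tau A B D C); auto.
  - intros v. destruct SA as [SA _]. destruct (SA v); auto.
  - intros u v E. apply (sep_edge A B) in E; auto. intuition.
Qed.

(** If [cap B D] were a small side, it would cover the graph together with the small sides [A] and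
    [C]. *)
Lemma tangle_cup k tau A B C D n : ktan k tau -> tau A B -> tau C D ->
  ord (cup A C) (cap B D) n -> okn k n -> tau (cup A C) (cap B D).
Proof.
  intros T H H' O Hn.
  assert (S := tangle_sep _ _ _ _ T H). assert (S' := tangle_sep _ _ _ _ T H').
  destruct (tangle_total k tau (cup A C) (cap B D) n) as [|X]; auto using sep_cup.
  exfalso. destruct T as (_ & _ & _ & _ & T). apply (T _ _ _ _ _ _ H H' X).
  unfold cup, cap. split.
  - intros v. destruct S as [S _], S' as [S' _]. specialize (S v); specialize (S' v); tauto.
  - intros u v E. apply (sep_edge A B) in E as E1; auto.
    apply (sep_edge C D) in E as E2; auto. tauto.
Qed.

Lemma tangle_small k tau X n : ktan k tau -> card_le X n -> okn k n -> tau X full.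
Proof.
  intros T C Hn.
  destruct (tangle_total k tau X full n) as [|H]; auto using sep_full.
  - apply ord_card. eapply card_sub; eauto. intros x [? ?]; auto.
  - exfalso; eapply tangle_not_full; eauto.
Qed.

Definition unionl (l : list (vset * vset)) : vset := fun x => exists p, In p l /\ fst p x.
Definition interl (l : list (vset * vset)) : vset := fun x => forall p, In p l -> snd p x.

Lemma unionl_cons p l : unionl (p :: l) = cup (fst p) (unionl l).
Proof.
  apply vset_ext; intros x; unfold unionl, cup; split.
  - intros (q & [<-|Hq] & Hx); eauto.
  - intros [Hx|(q & Hq & Hx)]; [exists p|exists q]; simpl; auto.
Qed.

Lemma interl_cons p l : interl (p :: l) = cap (snd p) (interl l).
Proof.
  apply vset_ext; intros x; unfold interl, cap; split.
  - intros H; split; [|intros q Hq]; apply H; simpl; auto.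
  - intros [Hx H] q [<-|Hq]; auto.
Qed.

Lemma unionl_nil : unionl [] = nil_set.
Proof. apply vset_ext; intros x; split; [intros (p & [] & _)|intros []]. Qed.

Lemma interl_nil : interl [] = full.
Proof. apply vset_ext; intros x; split; [unfold full; auto|intros _ p []]. Qed.

Lemma card_nil n : card_le nil_set n.
Proof. exists []; split; simpl; [lia|intros x []]. Qed.

(* The bound is on the order of every partial union, so that it also covers
   families whose unions have small order for other reasons than few members. *)
Lemma tangle_unionl k tau l n : ktan k tau -> okn k n ->
  (forall p, In p l -> tau (fst p) (snd p)) ->
  (forall l1 l2, l = l1 ++ l2 -> ord (unionl l2) (interl l2) n) ->
  tau (unionl l) (interl l).
Proof.
  intros T Hn. induction l as [|p l IH]; intros Hl HO.
  - rewrite unionl_nil, interl_nil. apply (tangle_small k tau _ n); auto using card_nil.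
  - assert (O := HO [] (p :: l) eq_refl). rewrite unionl_cons, interl_cons in *.
    apply (tangle_cup k tau _ _ _ _ n); auto.
    + apply Hl; simpl; auto.
    + apply IH; [intros q Hq; apply Hl; simpl; auto|].
      intros l1 l2 E. apply (HO (p :: l1)). rewrite E; auto.
Qed.

Lemma ord_unionl l a : (forall p, In p l -> ord (fst p) (snd p) a) ->
  ord (unionl l) (interl l) (length l * a).
Proof.
  induction l as [|p l IH]; intros H.
  - rewrite unionl_nil. exists []; split; simpl; auto.
  - rewrite unionl_cons, interl_cons.
    destruct (submodular (fst p) (snd p) (unionl l) (interl l) a (length l * a))
      as (x & y & Hxy & Ox & _).
    + apply H; simpl; auto.
    + apply IH; intros q Hq; apply H; simpl; auto.
    + apply ord_mono with x; auto. simpl; lia.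
Qed.

Lemma tangle_unionl_order k tau l a : ktan k tau -> okn k (length l * a) ->
  (forall p, In p l -> tau (fst p) (snd p) /\ ord (fst p) (snd p) a) ->
  tau (unionl l) (interl l).
Proof.
  intros T Hn H. apply (tangle_unionl k tau l (length l * a)); auto.
  - intros p Hp; apply H; auto.
  - intros l1 l2 ->. apply ord_mono with (length l2 * a).
    + rewrite length_app. nia.
    + apply ord_unionl. intros p Hp; apply H, in_or_app; auto.
Qed.

Hypothesis loc_fin : locally_finite adj.

(** * Tight separators *)

Definition full_side (X : vset) (q : V) : Prop :=
  ~ X q /\ forall x, X x -> exists y, adj x y /\ comp X q y.

(** Two distinct full components make [X] a minimal separator of any vertex of one from any vertex
    of the other. *)
Definition tight (X : vset) : Prop :=
  exists q r, full_side X q /\ full_side X r /\ ~ comp X q r.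

Lemma card_remove X p n : X p -> card_le X n ->
  exists m, n = S m /\ card_le (fun y => X y /\ y <> p) m.
Proof.
  intros Xp (l & Hl & H).
  assert (E := length_filter_dec V (fun y => y = p) l).
  assert (Hp : In p (filter (fun y => dec (y = p)) l)) by (apply in_filter_dec; auto).
  destruct (filter (fun y => dec (y = p)) l) as [|p' l'] eqn:E'; [destruct Hp|].
  simpl in E. destruct n as [|n]; [lia|]. exists n; split; auto.
  exists (filter (fun y => dec (y <> p)) l). split; [lia|].
  intros x [Xx Nx]. apply in_filter_dec; auto.
Qed.

(* Every separator meets a fixed u-v path; delete the common vertex and recurse. *)
Lemma minimal_separators_finite n : forall (Z : vset) u v, exists L : list vset,
  forall X, card_le X n -> ~ reach (fun y => ~ Z y /\ ~ X y) u v ->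
  (forall x, X x -> reach (fun y => ~ Z y /\ (X y -> y = x)) u v) -> In X L.
Proof.
  induction n as [|n IH]; intros Z u v.
  - exists [nil_set]. intros X C _ _. left. apply vset_ext; intros x; split; [intros []|].
    intros Xx. destruct (card_remove X x 0 Xx C) as (m & ? & _); discriminate.
  - destruct (classic (reach (fun y => ~ Z y) u v)) as [R|R].
    + destruct (reach_list _ _ _ R) as (l & Hl & Hpath).
      destruct (list_choice V vset l (fun p X' => card_le X' n /\
        ~ reach (fun y => ~ (Z y \/ y = p) /\ ~ X' y) u v /\
        (forall x, X' x -> reach (fun y => ~ (Z y \/ y = p) /\ (X' y -> y = x)) u v)))
        as [L HL].
      { intros p _. destruct (IH (fun y => Z y \/ y = p) u v) as [L HL].
        exists L. intros X' (? & ? & ?); auto. }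
      exists (flat_map (fun p => map (fun X' y => y = p \/ X' y) L) l).
      intros X C N M.
      assert (E : exists p, In p l /\ X p).
      { apply NNPP; intros E. apply N, Hpath. intros x Hx; split; auto.
        intros Xx; apply E; eauto. }
      destruct E as (p & Hp & Xp). apply in_flat_map. exists p; split; auto.
      apply in_map_iff. exists (fun y => X y /\ y <> p). split.
      { apply vset_ext; intros y; destruct (classic (y = p)) as [->|]; tauto. }
      destruct (card_remove X p _ Xp C) as (m & Em & Cm).
      injection Em as <-. apply (HL p); auto. split; auto. split.
      * intros R'. apply N. eapply reach_mono; [|exact R'].
        intros y [H1 H2]. split; tauto.
      * intros x [Xx Nx]. eapply reach_mono; [|apply (M x Xx)].
        intros y [H1 H2]. split; [|tauto]. intros [?|E]; auto. subst y.
        apply Nx; symmetry; auto.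
    + exists [nil_set]. intros X C _ M. left. apply vset_ext; intros x; split; [intros []|].
      intros Xx. apply R. eapply reach_mono; [|apply (M x Xx)]. intros y; tauto.
Qed.

(** In each of two full components [w] has a neighbour, and [X] is a minimal separator of these
    neighbours. Local finiteness leaves finitely many pairs of neighbours, each with finitely many
    minimal separators of bounded size. *)
Lemma tight_separators_finite w n : exists L : list vset,
  forall X, X w -> card_le X n -> tight X -> In X L.
Proof.
  destruct (loc_fin w) as [l Hl].
  destruct (list_choice (V * V) vset (list_prod l l) (fun p X => card_le X n /\
    ~ reach (fun y => ~ nil_set y /\ ~ X y) (fst p) (snd p) /\
    (forall x, X x -> reach (fun y => ~ nil_set y /\ (X y -> y = x)) (fst p) (snd p))))
    as [L HL].
  { intros [u v] _. destruct (minimal_separators_finite n nil_set u v) as [L HL].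
    exists L; intros X (? & ? & ?); auto. }
  exists L. intros X Xw C (q & r & [Nq Fq] & [Nr Fr] & N).
  destruct (Fq w Xw) as (y1 & E1 & R1), (Fr w Xw) as (y2 & E2 & R2).
  apply (HL (y1, y2)); [apply in_prod; auto|]. simpl. split; [auto|split].
  - intros R. apply N. apply reach_trans with y1; auto. apply reach_trans with y2.
    + eapply reach_mono; [|exact R]. unfold co; intros y; tauto.
    + apply reach_sym; auto.
  - intros x Xx. destruct (Fq x Xx) as (z1 & F1 & S1), (Fr x Xx) as (z2 & F2 & S2).
    assert (Hsub : sub (co X) (fun y => ~ nil_set y /\ (X y -> y = x)))
      by (unfold co, nil_set; intros y; tauto).
    apply reach_trans with z1.
    { eapply reach_mono; [exact Hsub|]. apply reach_trans with q; auto. apply reach_sym; auto. }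
    apply reach_trans with z2.
    { apply reach_step with x; auto.
      - apply Hsub. eapply comp_not; eauto.
      - apply reach_step with z2; auto.
        constructor. apply Hsub. eapply comp_not; eauto. }
    eapply reach_mono; [exact Hsub|]. apply reach_trans with r; auto. apply reach_sym; auto.
Qed.

Lemma comp_eq X q y : comp X q y -> comp X y = comp X q.
Proof.
  intros H. apply vset_ext; intros z; split; intros R.
  - eapply reach_trans; eauto.
  - apply reach_trans with q; auto. apply reach_sym; auto.
Qed.

(** Such a pair is determined by its boundary and any vertex of the full component whose closure is
    [A]. This is the form in which separations are counted. *)
Definition qsep (A B : vset) (q : V) : Prop :=
  A = cl (comp (cap A B) q) /\ B = co (comp (cap A B) q) /\ full_side (cap A B) q.

Lemma qseps_finite w n : exists L : list (vset * vset),
  forall A B q, A w -> B w -> ord A B n -> qsep A B q -> tight (cap A B) -> In (A, B) L.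
Proof.
  destruct (loc_fin w) as [l Hl]. destruct (tight_separators_finite w n) as [L HL].
  exists (flat_map (fun X => map (fun y => (cl (comp X y), co (comp X y))) l) L).
  intros A B q Aw Bw O (EA & EB & F) T.
  apply in_flat_map. exists (cap A B). split; [apply HL; auto; [split; auto|apply card_ord; auto]|].
  destruct F as [_ F]. destruct (F w) as (y & Ey & Ry); [split; auto|].
  apply in_map_iff. exists y; split; auto. rewrite (comp_eq _ _ _ Ry), <- EA, <- EB; auto.
Qed.

(** A vertex of [X] without a neighbour in the component is missing from the boundary of the
    separation that the component cuts off, whose order would then be below [n]. *)
Lemma full_side_of_order X q n : ~ X q -> card_le X n ->
  (forall m, ord (cl (comp X q)) (co (comp X q)) m -> n <= m) -> full_side X q.
Proof.
  intros Nq C H. split; auto. intros x Xx. apply NNPP; intros N.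
  destruct (card_remove X x n Xx C) as (m & -> & Cm).
  assert (S m <= m); [|lia]. apply H, ord_card. eapply card_sub; eauto.
  intros y Hy. split; [apply (comp_boundary X q); auto|]. intros ->.
  destruct Hy as [[Hy|(z & Hz & E)] Ny]; [auto|]. apply N; eauto.
Qed.

(** * The component in which a tangle lives *)

Definition conn (v : V) : vset := comp nil_set v.

Definition lives (tau : orient_set V) (v : V) : Prop := tau (co (conn v)) (conn v).

Lemma conn_nbr v x y : conn v x -> adj x y -> conn v y.
Proof. intros H E. apply comp_nbr with x; auto. Qed.

Lemma conn_refl v : conn v v.
Proof. apply comp_refl; auto. Qed.

Lemma conn_nbr_iff v x y : adj x y -> (conn v x <-> conn v y).
Proof. intros E; split; intros H; eapply conn_nbr; eauto. Qed.

Lemma comp_conn X v q x : conn v q -> comp X q x -> conn v x.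
Proof.
  intros H R. eapply reach_trans; [exact H|]. eapply reach_mono; [|exact R].
  unfold co, nil_set; intros y; tauto.
Qed.

Lemma conn_eq v x : conn v x -> conn x = conn v.
Proof. apply comp_eq. Qed.

Lemma sep_conn v : sep (co (conn v)) (conn v).
Proof.
  apply sep_of_edges.
  - intros x. unfold co. destruct (classic (conn v x)); auto.
  - intros x y E. unfold co. apply (conn_nbr_iff v) in E. tauto.
Qed.

Lemma ord_conn v n : ord (co (conn v)) (conn v) n.
Proof. exists []; split; simpl; [lia|]. unfold co; tauto. Qed.

(** Otherwise the tangle points away from all components of [conn v] minus [X]. Those are finitely
    many, since each contains [v] or a neighbour of [X], so their union is small; with [X] and the
    complement of [conn v], both small, it would cover the graph. *)
Lemma tangle_component k tau v X n : k_tangle V adj k tau -> okn k n -> lives tau v ->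
  card_le X n ->
  exists q, ~ X q /\ conn v q /\ tau (co (comp X q)) (cl (comp X q)).
Proof.
  intros T Hn Hv C. apply NNPP; intros N.
  assert (O : forall q, ord (cl (comp X q)) (co (comp X q)) n).
  { intros q. apply ord_card. eapply card_sub; [apply comp_boundary|auto]. }
  assert (H : forall q, ~ X q -> conn v q -> tau (cl (comp X q)) (co (comp X q))).
  { intros q Nq Cq. destruct (tangle_total k tau _ _ n T (sep_cl (comp X q)) (O q) Hn); auto.
    exfalso; apply N; eauto. }
  assert (HX := C). destruct HX as (lX & _ & HX).
  destruct (list_choice V V lX (fun x y => adj x y)) as [L HL]; [intros; apply loc_fin|].
  set (l := map (fun p => (cl (comp X p), co (comp X p)))
    (filter (fun p => dec (~ X p /\ conn v p)) (v :: L))).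
  assert (Hl : forall p, In p l -> exists q, ~ X q /\ conn v q /\
    p = (cl (comp X q), co (comp X q))).
  { intros p Hp. apply in_map_iff in Hp as (q & <- & Hq).
    apply in_filter_dec in Hq as [_ [? ?]]; eauto. }
  assert (TU : tau (unionl l) (interl l)).
  { apply (tangle_unionl k tau l n); auto.
    - intros p Hp. destruct (Hl p Hp) as (q & ? & ? & ->); simpl; auto.
    (* Every partial union has its boundary inside [X], so order [n] suffices however many
       components there are. *)
    - intros l1 l2 E. apply ord_card. eapply card_sub; [|exact C].
      intros x [(p & Hp & Hx) HI].
      destruct (Hl p) as (q & ? & ? & Ep); [rewrite E; apply in_or_app; auto|].
      specialize (HI p Hp). subst p. apply (comp_boundary X q); split; auto. }
  assert (Cov : forall x, ~ X x -> conn v x -> exists p, In p (v :: L) /\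
    ~ X p /\ conn v p /\ comp X p x).
  { intros x Nx Hx.
    enough (G : conn v x /\ (X x \/ exists p, In p (v :: L) /\ ~ X p /\ conn v p /\ comp X p x))
      by tauto.
    apply (reach_stable _ (fun x => conn v x /\
      (X x \/ exists p, In p (v :: L) /\ ~ X p /\ conn v p /\ comp X p x)) _ _ Hx).
    - split; [apply conn_refl|]. destruct (classic (X v)); auto.
      right. exists v. split; simpl; auto using conn_refl, comp_refl.
    - intros y z _ _ [Cy Hy] E. assert (Cz : conn v z) by (eapply conn_nbr; eauto).
      split; auto. destruct (classic (X z)) as [|Nz]; auto. right.
      destruct Hy as [Xy|(p & Hp & Np & Cp & Ry)].
      + exists z. split; [|auto using comp_refl]. right. apply (HL y); auto.
      + exists p. split; [|split; [|split]]; auto. eapply comp_nbr; eauto. }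
  assert (Cov' : forall x, ~ X x -> conn v x -> exists q, In (cl (comp X q), co (comp X q)) l
    /\ comp X q x).
  { intros x Nx Hx. destruct (Cov x Nx Hx) as (p & Hp & Np & Cp & Rp).
    exists p; split; auto. apply in_map_iff. exists p; split; auto. apply in_filter_dec; auto. }
  assert (TX := tangle_small k tau X n T C Hn).
  destruct T as (_ & _ & _ & _ & T). apply (T _ _ _ _ _ _ TU Hv TX). split.
  - intros x. destruct (classic (X x)); auto. destruct (classic (conn v x)); auto.
    left. destruct (Cov' x) as (q & Hq & Rq); auto. eexists; split; eauto. left; auto.
  - assert (G : forall x y, adj x y -> ~ X x ->
      (unionl l x /\ unionl l y) \/ (co (conn v) x /\ co (conn v) y)).
    { intros x y E Nx. destruct (classic (conn v x)) as [Cx|Cx].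
      - left. destruct (Cov' x) as (q & Hq & Rq); auto.
        split; eexists; (split; [eauto|]); [left|right]; eauto.
      - right. split; auto. intros Cy; apply Cx; eapply conn_nbr; eauto. }
    intros x y E. destruct (classic (X x)) as [Xx|Nx]; [|destruct (G x y E Nx); auto].
    destruct (classic (X y)) as [Xy|Ny]; auto.
    destruct (G y x (adj_sym _ _ E) Ny); tauto.
Qed.

(** * Compactness of the space of ends of a component *)

Inductive walk : nat -> V -> V -> Prop :=
| walk_0 : forall u, walk 0 u u
| walk_S : forall n u w v, adj u w -> walk n w v -> walk (S n) u v.

Lemma walk_trans m n u v w : walk m u v -> walk n v w -> walk (m + n) u w.
Proof. induction 1; simpl; auto. intros; eapply walk_S; eauto. Qed.

Definition isdist (v y : V) (d : nat) : Prop :=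
  walk d v y /\ forall d', walk d' v y -> d <= d'.

(* For x at distance n from v: the vertices y to which some geodesic from v runs through x. *)
Definition desc (v : V) (n : nat) (x y : V) : Prop :=
  exists m, walk m x y /\ isdist v y (n + m).

Lemma isdist_unique v y d d' : isdist v y d -> isdist v y d' -> d = d'.
Proof. intros [H1 H2] [H1' H2']. specialize (H2 _ H1'); specialize (H2' _ H1). lia. Qed.

Lemma conn_walk v y : conn v y -> exists d, isdist v y d.
Proof.
  intros H. apply least_nat. induction H as [u|u w v Pu E H [d Hd]].
  - exists 0; constructor.
  - exists (S d); econstructor; eauto.
Qed.

Lemma walk_conn v n x y : walk n x y -> conn v x -> conn v y.
Proof. induction 1; auto. intros; apply IHwalk. eapply conn_nbr; eauto. Qed.

Lemma isdist_step v n x x1 y m : isdist v x n -> adj x x1 -> walk m x1 y ->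
  isdist v y (n + S m) -> isdist v x1 (S n).
Proof.
  intros [W _] E W1 [_ Hmin]. split.
  - replace (S n) with (n + 1) by lia. apply walk_trans with x; auto.
    econstructor; eauto. constructor.
  - intros d Hd. specialize (Hmin _ (walk_trans _ _ _ _ _ Hd W1)). lia.
Qed.

(** Beyond distance [N] a geodesic from [v] no longer meets the separator, so it stays on its
    side. *)
Lemma desc_side C D v N : sep C D ->
  (forall x d, C x -> D x -> isdist v x d -> d <= N) ->
  forall m n x y, N < n -> isdist v x n -> C x -> ~ D x -> walk m x y ->
  isdist v y (n + m) -> C y /\ ~ D y.
Proof.
  intros Sep HN. induction m as [|m IH]; intros n x y Hn Dx Cx NDx W Dy.
  - inversion W; subst; auto.
  - inversion W as [|? ? x1 ? E W1]; subst.
    assert (D1 := isdist_step _ _ _ _ _ _ Dx E W1 Dy).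
    assert (C1 : C x1) by (eapply sep_nbr; eauto).
    apply (IH (S n) x1 y); auto.
    + intros X. specialize (HN x1 _ C1 X D1). lia.
    + replace (S n + m) with (n + S m) by lia; auto.
Qed.

(** No intersection with the second sides of finitely many members of [O] reduces [S] to a finite
    set. Bigness takes the place of infinity in Koenig's lemma. *)
Definition big (O : vset * vset -> Prop) (S : vset) : Prop :=
  ~ exists (l : list (vset * vset)) (F : list V),
      (forall p, In p l -> O p) /\ forall x, S x -> interl l x -> In x F.

Lemma interl_app l l' x : interl (l ++ l') x -> interl l x /\ interl l' x.
Proof. intros H; split; intros p Hp; apply H, in_or_app; auto. Qed.

Lemma big_pick O S (I : Type) (l : list I) (S' : I -> vset) F0 : big O S ->
  (forall x, S x -> In x F0 \/ exists i, In i l /\ S' i x) ->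
  exists i, In i l /\ big O (S' i).
Proof.
  intros HS H. apply NNPP; intros N. apply HS.
  enough (G : exists lO F, (forall p, In p lO -> O p) /\
    forall i x, In i l -> S' i x -> interl lO x -> In x F).
  { destruct G as (lO & F & H1 & H2). exists lO, (F0 ++ F). split; auto.
    intros x Sx Ix. apply in_or_app. destruct (H x Sx) as [|(i & Hi & Si)]; eauto. }
  assert (N' : forall i, In i l -> ~ big O (S' i)) by (intros i Hi X; apply N; eauto).
  clear - N'. induction l as [|i l IH].
  - exists [], []. simpl; tauto.
  - destruct IH as (lO & F & H1 & H2); [intros; apply N'; simpl; auto|].
    assert (Ni := N' i (or_introl eq_refl)). apply NNPP in Ni as (l1 & F1 & H3 & H4).
    exists (l1 ++ lO), (F1 ++ F). split.
    + intros p Hp; apply in_app_or in Hp as [?|?]; auto.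
    + intros j x Hj Sx Ix. apply interl_app in Ix as [I1 I2]. apply in_or_app.
      destruct Hj as [<-|Hj]; eauto.
Qed.

Lemma dependent_choice (P : nat -> V -> Prop) v : P 0 v ->
  (forall n x, P n x -> exists y, adj x y /\ P (S n) y) ->
  exists r : nat -> V, forall n, P n (r n) /\ adj (r n) (r (S n)).
Proof.
  intros H0 HS.
  assert (f : forall n x, {y | P n x -> adj x y /\ P (S n) y}).
  { intros n x. apply constructive_indefinite_description.
    destruct (classic (P n x)) as [H|H]; [destruct (HS n x H) as [y Hy]; eauto|].
    exists x; tauto. }
  set (r := fix r n := match n with 0 => v | S n => proj1_sig (f n (r n)) end).
  assert (Hr : forall n, P n (r n)).
  { induction n as [|n IH]; simpl; auto. apply (proj2_sig (f n (r n))); auto. }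
  exists r. intros n; split; auto. simpl. apply (proj2_sig (f n (r n))); auto.
Qed.

(** Otherwise [conn v] is big, and following big sets of descendants yields a geodesic ray from [v].
    Some member of [O] has a tail of this ray strictly on its first side; the late descendants lie
    there as well, so this one member removes all of them, contrary to bigness. *)
Lemma compactness v (O : vset * vset -> Prop) :
  (forall p, O p -> sep (fst p) (snd p) /\ finite_order V (fst p) (snd p)) ->
  (forall r, ray V adj r -> (forall n, conn v (r n)) ->
    exists p, O p /\ ~ endo r (fst p) (snd p)) ->
  exists l F, (forall p, In p l -> O p) /\ forall x, conn v x -> interl l x -> In x F.
Proof.
  intros HO Hray. apply NNPP; intros N. change (big O (conn v)) in N.
  destruct (dependent_choice (fun n x => isdist v x n /\ big O (desc v n x)) v) as [r Hr].
  - split; [split; [constructor|lia]|]. intros (l & F & H1 & H2). apply N.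
    exists l, F; split; auto. intros x Cx. apply H2.
    destruct (conn_walk v x Cx) as [d Hd]. exists d; split; [apply Hd|auto].
  - intros n x [Dx Bx]. destruct (loc_fin x) as [nb Hnb].
    destruct (big_pick O (desc v n x) V nb
      (fun y z => adj x y /\ isdist v y (S n) /\ desc v (S n) y z) [x] Bx)
      as (y & Hy & By).
    + intros z (m & W & Dz). inversion W as [|m' ? x1 ? E W1]; subst; [left; simpl; auto|].
      right. exists x1; split; auto. split; auto. split.
      * eapply isdist_step; eauto.
      * exists m'; split; auto. replace (S n + m') with (n + S m') by lia; auto.
    + assert (G : adj x y /\ isdist v y (S n)).
      { apply NNPP; intros X. apply By. exists [], []. split; [simpl; tauto|].
        intros z (? & ? & _); tauto. }
      exists y. split; [tauto|split; [tauto|]].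
      intros (l & F & H1 & H2). apply By. exists l, F; split; auto.
      intros z (_ & _ & Dz); auto.
  - assert (Rr : ray V adj r).
    { split; [|apply Hr]. intros m n E. destruct (Hr m) as [[Dm _] _], (Hr n) as [[Dn _] _].
      rewrite E in Dm. eapply isdist_unique; eauto. }
    destruct (Hray r Rr) as ([C D] & Op & Np).
    { intros n. destruct (Hr n) as [[[W _] _] _]. eapply walk_conn; eauto using conn_refl. }
    apply Np. destruct (HO _ Op) as [Sp F]. simpl in *.
    split; [auto|split; auto]. destruct F as [lX HX].
    destruct (list_bound V lX (fun x n => forall d, isdist v x d -> d <= n)) as [M HM].
    { intros x m n Hmn H d Hd. specialize (H d Hd); lia. }
    { intros x _. destruct (classic (exists d, isdist v x d)) as [[d Hd]|Nd].
      - exists d. intros d' Hd'. rewrite (isdist_unique _ _ _ _ Hd Hd'); auto.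
      - exists 0. intros d Hd; exfalso; eauto. }
    exists (S M). intros n Hn. destruct (Hr n) as [[Dn Bn] _].
    assert (NX : ~ (C (r n) /\ D (r n))).
    { intros [HC HD]. specialize (HM _ (HX _ HC HD) _ Dn). lia. }
    destruct (classic (C (r n))) as [HC|HC];
      [|split; auto; eapply sep_compl_cover; eauto].
    exfalso. apply Bn. exists [(C, D)], []. split; [intros p [<-|[]]; auto|].
    intros x (m & W & Dx) Ix. specialize (Ix (C, D) (or_introl eq_refl)). simpl in Ix.
    assert (ND : ~ D (r n)) by (intros HD; apply NX; auto).
    destruct (desc_side C D v M Sp) with (m := m) (n := n) (x := r n) (y := x); auto;
      [|contradiction].
    intros z d Cz Dz Hd. exact (HM z (HX z Cz Dz) d Hd).
Qed.

(** * Minimal separations between a tangle and an end *)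

(* As the members of a tangle point to their second component, [tau B A] says that
   tau lies on the A-side; the end of r lies on the B-side. *)
Record cut (k : option nat) (tau : orient_set V) (r : nat -> V) (n : nat) (A B : vset) : Prop := {
  cut_tangle : k_tangle V adj k tau;
  cut_okn : okn k n;
  cut_ray : ray V adj r;
  cut_tau : tau B A;
  cut_endo : endo r A B;
  cut_ord : ord A B n;
  cut_least : forall C D m, tau D C -> endo r C D -> ord C D m -> n <= m }.

Definition mincut k tau r n A B : Prop :=
  cut k tau r n A B /\
  forall C D, cut k tau r n C D -> sub C A -> sub B D -> sub A C /\ sub D B.

Lemma endo_sep r A B : endo r A B -> sep A B.
Proof. intros H; apply H. Qed.

Lemma endo_fin r A B : endo r A B -> finite_order V A B.
Proof. intros H; apply H. Qed.

Lemma cut_other k tau r n A B C D : cut k tau r n A B ->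
  tau D C -> endo r C D -> ord C D n -> cut k tau r n C D.
Proof. intros [] ? ? ?; constructor; auto. Qed.

(** For [m < n] the tangle orients [(C, D)] and by [tangle_mono] lies on the side of [C], against
    the leastness of [n]. *)
Lemma cut_sup k tau r n A B C D m : cut k tau r n A B ->
  endo r C D -> ord C D m -> sub A C -> n <= m.
Proof.
  intros H E O S. destruct (le_lt_dec n m) as [|L]; auto.
  apply (cut_least _ _ _ _ _ _ H C D); auto.
  apply (tangle_mono k tau B A D C m); auto using sep_sym, ord_sym.
  - apply H.
  - apply H.
  - apply sep_sym, (endo_sep r); auto.
  - apply okn_le with n; [lia|apply H].
Qed.

Lemma cl_comp_sub A B q : sep A B -> A q -> ~ B q ->
  sub (cl (comp (cap A B) q)) A /\ sub B (co (comp (cap A B) q)).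
Proof.
  intros S Aq Bq. split.
  - intros x [Hx|(y & Hy & E)].
    + apply (reach_side A B q); auto.
    + destruct (reach_side A B q y S Hy Aq Bq). eapply sep_nbr; eauto.
  - intros x Bx Hx. destruct (reach_side A B q x S Hx Aq Bq). auto.
Qed.

(** Shrink [A] to the closure of the component to which the tangle points once the boundary is
    deleted. That component lies on the [A]-side, since otherwise [B] and its complement would cover
    the graph; leastness of the order makes it full. *)
Lemma cut_reduce k tau r n A B v : cut k tau r n A B -> lives tau v ->
  exists q, conn v q /\ A q /\ ~ B q /\
    let Q := comp (cap A B) q in
    sub (cl Q) A /\ sub B (co Q) /\ cut k tau r n (cl Q) (co Q) /\ qsep (cl Q) (co Q) q.
Proof.
  intros H L. assert (T := cut_tangle _ _ _ _ _ _ H).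
  assert (S := endo_sep _ _ _ (cut_endo _ _ _ _ _ _ H)).
  assert (CX := card_ord _ _ _ (cut_ord _ _ _ _ _ _ H)).
  destruct (tangle_component k tau v (cap A B) n T (cut_okn _ _ _ _ _ _ H) L CX)
    as (q & Nq & Cq & Tq).
  set (Q := comp (cap A B) q) in *.
  assert (Aq : A q /\ ~ B q).
  { apply NNPP; intros N.
    assert (Bq : B q /\ ~ A q).
    { destruct S as [S _]. specialize (S q). unfold cap in Nq. tauto. }
    destruct (cl_comp_sub B A q) as [S1 S2]; try tauto; [apply sep_sym; auto|].
    replace (cap B A) with (cap A B) in * by (apply vset_ext; unfold cap; tauto).
    fold Q in S1, S2.
    apply (tangle_no_cover2 k tau B A (co Q) (cl Q)); auto.
    - apply H.
    - intros x. destruct (classic (Q x)); [left; apply S1; left; auto|right; auto].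
    - intros x y E. assert (E' := adj_sym _ _ E). destruct (classic (Q x)); [left|].
      + split; apply S1; [left; auto|right; eauto].
      + destruct (classic (Q y)); [left|right; split; auto].
        split; apply S1; [right; eauto|left; auto]. }
  destruct Aq as [Aq Bq].
  destruct (cl_comp_sub A B q S Aq Bq) as [S1 S2]. fold Q in S1, S2.
  assert (C : cut k tau r n (cl Q) (co Q)).
  { apply cut_other with A B; auto.
    - apply endo_mono with A B; auto using sep_cl.
      + apply H.
      + apply ord_fin with n, ord_card. eapply card_sub; [apply comp_boundary|auto].
    - apply ord_card. eapply card_sub; [apply comp_boundary|auto]. }
  assert (F : full_side (cap A B) q).
  { apply full_side_of_order with n; auto. fold Q. intros m Hm.
    apply (cut_least _ _ _ _ _ _ C (cl Q) (co Q)); auto; apply C. }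
  assert (E : cap (cl Q) (co Q) = cap A B).
  { apply sub_antisym; [apply comp_boundary|]. intros x Xx.
    destruct F as [_ F]. destruct (F x Xx) as (y & Ey & Hy). split.
    - right; exists y; auto.
    - intros Hx. apply (comp_not _ _ _ Hx); auto. }
  exists q. simpl. fold Q. repeat (split; [assumption|]).
  unfold qsep. rewrite E. auto.
Qed.

Lemma mincut_qsep k tau r n A B v : mincut k tau r n A B -> lives tau v ->
  exists q, conn v q /\ A q /\ ~ B q /\ qsep A B q.
Proof.
  intros [H M] L. destruct (cut_reduce _ _ _ _ _ _ v H L) as (q & Cq & Aq & Bq & S1 & S2 & C & Q).
  destruct (M _ _ C S1 S2) as [S3 S4].
  rewrite (sub_antisym _ _ S1 S3), (sub_antisym _ _ S4 S2) in Q. eauto.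
Qed.

(** A tail of the ray lies in one component on the [F]-side, and cutting off this component alone
    gives a separation that competes with [(E, F)]. Leastness is asked only against larger [E], so
    the lemma serves both for a tangle against an end and for two ends. *)
Lemma ray_side_full r E F e : ray V adj r -> endo r E F -> ord E F e ->
  (forall C D m, endo r C D -> sub E C -> sub D F -> ord C D m -> e <= m) ->
  exists m, F (r m) /\ ~ E (r m) /\ full_side (cap E F) (r m) /\
    forall i, m <= i -> comp (cap E F) (r m) (r i).
Proof.
  intros Rr (S & Fin & m & Hm) O H. set (X := cap E F) in *.
  assert (Nm : forall i, m <= i -> co X (r i)) by (intros i Hi [? ?]; apply (Hm i Hi); auto).
  destruct (Hm m (le_n m)) as [Fm Em].
  destruct (cl_comp_sub F E (r m)) as [S1 S2]; auto using sep_sym.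
  replace (cap F E) with X in * by (apply vset_ext; unfold X, cap; tauto).
  assert (RR : forall i, m <= i -> comp X (r m) (r i)) by (intros; apply ray_reach; auto).
  exists m. do 2 (split; [assumption|]). split; [|exact RR].
  set (R := comp X (r m)) in *.
  apply full_side_of_order with e; [apply (Nm m); auto|apply card_ord, O|].
  fold R. intros i Oi. apply (H (co R) (cl R)); auto using ord_sym.
  split; [apply sep_sym, sep_cl|split; [apply fin_sym; eapply ord_fin; eauto|]].
  exists m. intros j Hj. split; [left; auto|]. intros N; apply N, RR; auto.
Qed.

Lemma cut_tight k tau r n A B q : cut k tau r n A B -> qsep A B q -> tight (cap A B).
Proof.
  intros H (EA & EB & F).
  destruct (ray_side_full r A B n) as (m & Bm & Am & Fm & _); try apply H.
  { intros C D m E S _ O. eapply cut_sup; eauto. }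
  exists q, (r m). split; [auto|split; auto].
  intros R'. apply Am. rewrite EA. left; auto.
Qed.

Lemma connecting_list b (T : list V) : (forall t, In t T -> reach (co nil_set) b t) ->
  exists Y : list V, forall X, (forall y, In y Y -> ~ X y) ->
    forall t, In t T -> reach (co X) b t.
Proof.
  induction T as [|t T IH]; intros H.
  - exists []. simpl; tauto.
  - destruct IH as [Y HY]; [intros; apply H; simpl; auto|].
    destruct (reach_list _ _ _ (H t (or_introl eq_refl))) as (l & _ & Hl).
    exists (l ++ Y). intros X HX t' [<-|Ht'].
    + apply Hl. intros x Hx. apply HX, in_or_app; auto.
    + apply HY; auto. intros y Hy. apply HX, in_or_app; auto.
Qed.

(* If the separator missed a finite connected set Y containing b, F and all
   separators of l, the connected side Q of (A,B) would lie inside a single C with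
   (C,D) in l, and then (C,D) and (B,A) would cover the graph. *)
Lemma cuts_finite v l F b n :
  (forall p, In p l -> finite_order V (fst p) (snd p)) ->
  (forall x, conn v x -> interl l x -> In x F) -> conn v b ->
  exists L : list (vset * vset), forall k tau r A B q,
    cut k tau r n A B -> qsep A B q -> conn v q -> B b ->
    (forall p, In p l -> tau (fst p) (snd p) \/ sub A (snd p)) -> In (A, B) L.
Proof.
  intros Hfin HF Cb.
  destruct (list_choice (vset * vset) V l (fun p x => fst p x /\ snd p x)) as [LX HLX].
  { intros p Hp. destruct (Hfin p Hp) as [lp Hlp]. exists lp; intros x [? ?]; auto. }
  destruct (connecting_list b (filter (fun x => dec (conn v x)) (F ++ LX))) as [Y HY].
  { intros t Ht. apply in_filter_dec in Ht as [_ Ht]. fold (comp nil_set b t).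
    fold (conn b). rewrite (conn_eq v b); auto. }
  destruct (list_choice V (vset * vset) (b :: Y) (fun y p =>
    fst p y /\ snd p y /\ ord (fst p) (snd p) n /\
    (exists q, qsep (fst p) (snd p) q) /\ tight (cap (fst p) (snd p)))) as [L HL].
  { intros y _. destruct (qseps_finite y n) as [L HL]. exists L.
    intros [A B] (? & ? & ? & (q & ?) & ?). eapply HL; eauto. }
  exists L. intros k tau r A B q H Q Cq Bb Hl.
  assert (T := cut_tight _ _ _ _ _ _ _ H Q).
  assert (S := endo_sep _ _ _ (cut_endo _ _ _ _ _ _ H)).
  destruct (classic (exists y, In y (b :: Y) /\ A y /\ B y)) as [(y & Hy & Ay & By)|N].
  { apply (HL y); simpl; auto. repeat split; eauto. apply H. }
  exfalso.
  assert (Ab : ~ A b) by (intros Ab; apply N; exists b; simpl; auto).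
  assert (HT : forall t, In t (F ++ LX) -> conn v t -> ~ A t).
  { intros t Ht Ct. apply (reach_side B A b); auto using sep_sym.
    apply HY.
    - intros y Hy [? ?]. apply N. exists y; simpl; auto.
    - apply in_filter_dec; auto. }
  destruct Q as (EA & EB & FQ).
  assert (AQ : sub (comp (cap A B) q) A) by (intros x Hx; rewrite EA; left; auto).
  assert (Qq : comp (cap A B) q q) by (apply comp_refl, FQ).
  assert (Dq : exists p, In p l /\ ~ snd p q).
  { apply NNPP; intros N'. apply (HT q); auto. apply in_or_app; left. apply HF; auto.
    intros p Hp. apply NNPP; intros ?; apply N'; eauto. }
  destruct Dq as ([C D] & Hp & Nq). simpl in Nq.
  destruct (Hl _ Hp) as [Tp|Sp]; [simpl in Tp|apply Nq, Sp, AQ, Qq].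
  assert (TT := cut_tangle _ _ _ _ _ _ H).
  assert (SC := tangle_sep _ _ _ _ TT Tp).
  assert (HQ : forall x, comp (cap A B) q x -> C x /\ ~ D x).
  { intros x Hx. apply (reach_side C D q); auto.
    - eapply reach_mono; [|apply reach_strengthen; exact Hx].
      intros y Hy [Cy Dy]. apply (HT y).
      + apply in_or_app; right. apply (HLX (C, D)); auto.
      + apply (comp_conn (cap A B) v q); auto.
      + apply AQ; auto.
    - eapply sep_compl_cover; [apply sep_sym; eauto|auto]. }
  apply (tangle_no_cover2 k tau C D B A); auto.
  - apply H.
  - intros x. rewrite EB. unfold co. destruct (classic (comp (cap A B) q x)); auto.
    left; apply HQ; auto.
  - assert (G : forall x y, adj x y -> comp (cap A B) q x -> C x /\ C y).
    { intros x y E Hx. destruct (HQ x Hx). split; auto. eapply sep_nbr; eauto. }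
    intros x y E. rewrite EB. unfold co at 1 2.
    destruct (classic (comp (cap A B) q x)) as [Hx|Hx]; [left; eapply G; eauto|].
    destruct (classic (comp (cap A B) q y)) as [Hy|Hy]; auto.
    left. destruct (G y x); auto.
Qed.

(** By [cuts_finite] only finitely many cuts below [(A0, B0)] have the form [qsep] with a vertex of
    [conn v], and [cut_reduce] finds one of them below every cut. So a minimal one among these is
    minimal among all. *)
Lemma mincut_exists v l F b k tau r n A0 B0 :
  cut k tau r n A0 B0 -> lives tau v ->
  (forall p, In p l -> finite_order V (fst p) (snd p)) ->
  (forall x, conn v x -> interl l x -> In x F) -> conn v b -> B0 b ->
  (forall p, In p l -> tau (fst p) (snd p) \/ sub A0 (snd p)) ->
  exists A B, mincut k tau r n A B.
Proof.
  intros H Lv Hfin HF Cb Bb Hl.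
  destruct (cuts_finite v l F b n Hfin HF Cb) as [L HL].
  destruct (finite_minimal (vset * vset)
    (fun p p' => sub (fst p) (fst p') /\ sub (snd p') (snd p)) L) with
    (P := fun p => cut k tau r n (fst p) (snd p) /\ sub (fst p) A0 /\ sub B0 (snd p) /\
      exists q, conn v q /\ qsep (fst p) (snd p) q)
    as ([A B] & (HAB & SA & SB & q & Cq & Qq) & Min).
  - intros x y z [H1 H2] [H3 H4]; split; intros u Hu; auto.
  - intros x; split; intros u Hu; auto.
  - intros [A B] (HAB & SA & SB & q & Cq & Qq). simpl in *.
    apply (HL k tau r A B q); auto.
    intros p Hp. destruct (Hl p Hp) as [|Sp]; auto. right; intros x Ax; auto.
  - destruct (cut_reduce _ _ _ _ _ _ v H Lv) as (q & Cq & Aq & Bq & S1 & S2 & C & Q).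
    eexists (_, _); simpl; eauto 8.
  - simpl in *. exists A, B. split; auto. intros C D HCD SC SD.
    destruct (cut_reduce _ _ _ _ _ _ v HCD Lv) as (q' & Cq' & _ & _ & S1 & S2 & HC & HQ).
    set (Q := comp (cap C D) q') in *.
    destruct (Min (cl Q, co Q)) as [M1 M2]; simpl in *.
    + split; [exact HC|split; [|split]].
      * intros x Hx. apply SA, SC, S1, Hx.
      * intros x Hx. apply S2, SD, SB, Hx.
      * exists q'; split; auto.
    + split; intros x Hx; auto.
    + split; intros x Hx; auto.
Qed.

Lemma cut_lives k tau r n A B : cut k tau r n A B -> 0 < n -> lives tau (r 0).
Proof.
  intros H Hn. unfold lives.
  destruct (tangle_total k tau (co (conn (r 0))) (conn (r 0)) 0) as [|T]; auto.
  - apply H.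
  - apply sep_conn.
  - apply ord_conn.
  - apply okn_le with n; [lia|apply H].
  - exfalso. assert (n <= 0); [|lia].
    apply (cut_least _ _ _ _ _ _ H (co (conn (r 0))) (conn (r 0))); auto using ord_conn.
    split; [apply sep_conn|split; [eapply ord_fin, (ord_conn _ 0)|]].
    exists 0. intros i _.
    assert (conn (r 0) (r i)).
    { apply ray_reach; [apply H|intros ? ? []|lia]. }
    split; auto.
Qed.

(** The pair with first side [cup A A'] points to the end and has order at least [n'], so the corner
    [cap A A'] has order at most [n]. If [tau'] lies on the [B]-side, the corner [cap A B'] has
    order at most [n] as well, [tau] lies in one of the two corners, and minimality makes that
    corner all of [A]. If [tau'] lies on the [A]-side, then [n = n'] and minimality of [A'] puts it
    inside [A]. *)
Lemma mincut_nested k tau k' tau' r n n' A B A' B' :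
  mincut k tau r n A B -> mincut k' tau' r n' A' B' -> n <= n' ->
  (sub A A' /\ sub B' B) \/ (sub A B' /\ sub A' B) \/ (n = n' /\ sub A' A /\ sub B B').
Proof.
  intros [H M] [H' M'] Hn.
  assert (T := cut_tangle _ _ _ _ _ _ H). assert (T' := cut_tangle _ _ _ _ _ _ H').
  assert (E := cut_endo _ _ _ _ _ _ H). assert (E' := cut_endo _ _ _ _ _ _ H').
  assert (S := endo_sep _ _ _ E). assert (S' := endo_sep _ _ _ E').
  assert (O := cut_ord _ _ _ _ _ _ H). assert (O' := cut_ord _ _ _ _ _ _ H').
  assert (Ok := cut_okn _ _ _ _ _ _ H). assert (Ok' := cut_okn _ _ _ _ _ _ H').
  assert (R := cut_tau _ _ _ _ _ _ H). assert (R' := cut_tau _ _ _ _ _ _ H').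
  assert (Ecap : endo r (cap A A') (cup B B')) by (apply endo_cap; auto; eapply endo_fin; eauto).
  assert (Ocap : ord (cap A A') (cup B B') n).
  { destruct (submodular A B A' B' n n' O O') as (p & q & Hpq & Op & Oq).
    assert (n' <= p).
    { apply (cut_sup _ _ _ _ _ _ (cup A A') (cap B B') p H'); auto.
      - apply endo_cup; auto.
      - intros x; right; auto. }
    apply ord_mono with q; auto; lia. }
  destruct (tangle_total k' tau' A B n) as [D|D]; auto.
  { apply okn_le with n'; auto. }
  - assert (Ocap' : ord (cap A B') (cup B A') n).
    { destruct (submodular A B B' A' n n' O (ord_sym _ _ _ O')) as (p & q & Hpq & Op & Oq).
      assert (n' <= p).
      { destruct (le_lt_dec n' p) as [|L]; auto.
        apply (cut_least _ _ _ _ _ _ H' (cap B A') (cup A B')); auto using ord_sym.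
        - apply (tangle_cup k' tau' A B B' A' p); auto.
          apply okn_le with n'; auto; lia.
        - replace (cap B A') with (cap A' B) by (apply vset_ext; unfold cap; tauto).
          replace (cup A B') with (cup B' A) by (apply vset_ext; unfold cup; tauto).
          apply endo_cap; auto using sep_sym, fin_sym.
          apply fin_sym; eapply endo_fin; eauto. }
      apply ord_mono with q; auto; lia. }
    destruct (tangle_total k tau (cap A A') (cup B B') n) as [X|X]; auto.
    { eapply endo_sep; eauto. }
    + destruct (tangle_total k tau (cap A B') (cup B A') n) as [X'|X']; auto.
      { apply sep_cap; auto using sep_sym. }
      * exfalso. destruct T as (_ & _ & _ & _ & T). apply (T _ _ _ _ _ _ X X' R).
        unfold cap. split.
        -- intros x. destruct S as [S _], S' as [S' _]. specialize (S x); specialize (S' x); tauto.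
        -- intros x y F. apply (sep_edge A B) in F as F1; auto.
           apply (sep_edge A' B') in F as F2; auto. tauto.
      * right; left. destruct (M (cap A B') (cup B A')) as [M1 M2].
        -- apply cut_other with A B; auto.
           apply endo_cap; auto using sep_sym. apply fin_sym; eapply endo_fin; eauto.
        -- intros x [? ?]; auto.
        -- intros x; left; auto.
        -- split; intros x Hx; [apply M1|apply M2; right]; auto.
    + left. destruct (M (cap A A') (cup B B')) as [M1 M2].
      * apply cut_other with A B; auto.
      * intros x [? ?]; auto.
      * intros x; left; auto.
      * split; intros x Hx; [apply M1|apply M2; right]; auto.
  - right; right.
    assert (n' <= n) by (apply (cut_least _ _ _ _ _ _ H' A B); auto).
    assert (n = n') by lia. subst n'. split; auto.
    destruct (M' (cap A A') (cup B B')) as [M1 M2].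
    + apply cut_other with A' B'; auto.
      apply (tangle_cup k' tau' B A B' A' n); auto using ord_sym.
    + intros x [? ?]; auto.
    + intros x; right; auto.
    + split; intros x Hx; [apply M1|apply M2; left]; auto.
Qed.

(** * Transport along automorphisms *)

(** Sets are moved by preimages, so the image of [A] under [f] is [pull g A] for the inverse [g]. *)
Definition pull (f : V -> V) (A : vset) : vset := fun x => A (f x).
Definition push (f : V -> V) (tau : orient_set V) : orient_set V :=
  fun A B => tau (pull f A) (pull f B).
Definition move (f : V -> V) (r : nat -> V) : nat -> V := fun n => f (r n).

Definition auto_pair (f g : V -> V) : Prop :=
  (forall x, g (f x) = x) /\ (forall y, f (g y) = y) /\
  (forall x y, adj x y <-> adj (f x) (f y)).

Lemma auto_pair_sym f g : auto_pair f g -> auto_pair g f.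
Proof.
  intros (H1 & H2 & H3). split; [auto|split; [auto|]].
  intros x y. rewrite (H3 (g x)), !H2. tauto.
Qed.

Lemma auto_pair_comp f g f' g' : auto_pair f g -> auto_pair f' g' ->
  auto_pair (fun x => f' (f x)) (fun x => g (g' x)).
Proof.
  intros (H1 & H2 & H3) (H1' & H2' & H3'). split; [|split].
  - intros x. rewrite H1', H1; auto.
  - intros x. rewrite H2, H2'; auto.
  - intros x y. rewrite H3, H3'. tauto.
Qed.

Lemma pull_pull f g A : auto_pair f g -> pull f (pull g A) = A.
Proof. intros (H & _). apply vset_ext; intros x; unfold pull; rewrite H; tauto. Qed.

Lemma move_move f g r : auto_pair f g -> move g (move f r) = r.
Proof. intros (H & _). apply functional_extensionality; intros n; apply H. Qed.

Lemma sep_pull f g A B : auto_pair f g -> sep A B -> sep (pull f A) (pull f B).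
Proof.
  intros (_ & _ & H) S. unfold pull. apply sep_of_edges.
  - intros x; apply S.
  - intros x y E. apply (sep_edge A B); auto. apply -> H; auto.
Qed.

Lemma ord_pull f g A B n : auto_pair f g -> ord A B n -> ord (pull f A) (pull f B) n.
Proof.
  intros (H & _) (l & Hl & HX). exists (map g l). rewrite length_map. split; auto.
  intros x Ax Bx. apply in_map_iff. exists (f x); split; auto.
Qed.

Lemma fin_pull f g A B : auto_pair f g -> finite_order V A B ->
  finite_order V (pull f A) (pull f B).
Proof.
  intros H F. destruct (fin_ord _ _ F) as [n O]. eapply ord_fin, ord_pull; eauto.
Qed.

Lemma ray_move f g r : auto_pair f g -> ray V adj r -> ray V adj (move f r).
Proof.
  intros (H & _ & H') [R1 R2]. unfold move. split.
  - intros m n E. apply R1. rewrite <- (H (r m)), <- (H (r n)), E; auto.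
  - intros n. rewrite <- H'; auto.
Qed.

Lemma endo_pull f g r A B : auto_pair f g -> endo (move f r) A B -> endo r (pull f A) (pull f B).
Proof.
  intros H (S & F & m & Hm). split; [eapply sep_pull; eauto|split; [eapply fin_pull; eauto|]].
  exists m. exact Hm.
Qed.

Lemma endo_move f g r A B : auto_pair f g -> endo r A B -> endo (move f r) (pull g A) (pull g B).
Proof.
  intros H E. apply (endo_pull g f); [apply auto_pair_sym; auto|].
  rewrite (move_move f g); auto.
Qed.

Lemma conn_move f g v x : auto_pair f g -> conn v x -> conn (f v) (f x).
Proof.
  intros (_ & _ & H) C. induction C as [u Pu|u w v Pu E C IH].
  - apply conn_refl.
  - eapply reach_step; [intros []| |exact IH]. rewrite <- H; auto.
Qed.

Lemma pull_conn f g v : auto_pair f g -> pull f (conn (f v)) = conn v.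
Proof.
  intros H. apply vset_ext; intros x; unfold pull; split; intros C.
  - apply (conn_move g f) in C; [|apply auto_pair_sym; auto].
    destruct H as (H & _). rewrite !H in C; auto.
  - eapply conn_move; eauto.
Qed.

Lemma in_S_pull f g k A B : auto_pair f g -> in_S V adj k A B ->
  in_S V adj k (pull f A) (pull f B).
Proof.
  intros H [S O]. split; [eapply sep_pull; eauto|].
  destruct k; simpl in *.
  - destruct O as (m & ? & ?); exists m; split; auto. eapply ord_pull; eauto.
  - eapply fin_pull; eauto.
Qed.

Lemma tangle_push f g k tau : auto_pair f g -> k_tangle V adj k tau ->
  k_tangle V adj k (push f tau).
Proof.
  intros H (T1 & T2 & T3 & T4 & T5). unfold push.
  assert (H' := auto_pair_sym _ _ H). split; [|split; [|split; [|split]]].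
  - intros A B A' B' E E' HT. replace A' with A by (apply vset_ext; auto).
    replace B' with B by (apply vset_ext; auto); auto.
  - intros A B HT. apply T2, (in_S_pull g f) in HT; auto.
    rewrite !(pull_pull g f) in HT; auto.
  - intros A B HS. apply T3. eapply in_S_pull; eauto.
  - intros A B HT HT'. assert (E := T4 _ _ HT HT').
    intros x. specialize (E (g x)). unfold pull in E.
    destruct H as (_ & H & _). rewrite H in E; auto.
  - intros A1 B1 A2 B2 A3 B3 H1 H2 H3 [C1 C2]. apply (T5 _ _ _ _ _ _ H1 H2 H3).
    unfold pull; split; auto. intros x y E. apply C2. destruct H as (_ & _ & H). apply -> H; auto.
Qed.

Lemma lives_push f g tau v : auto_pair f g -> lives tau v -> lives (push f tau) (f v).
Proof.
  intros H L. unfold lives, push. rewrite (pull_conn f g); auto.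
  replace (pull f (co (conn (f v)))) with (co (conn v)); auto.
  rewrite <- (pull_conn f g) by auto. reflexivity.
Qed.

Lemma cut_push f g k tau r n A B : auto_pair f g -> cut k tau r n A B ->
  cut k (push f tau) (move f r) n (pull g A) (pull g B).
Proof.
  intros H C. assert (H' := auto_pair_sym _ _ H). constructor.
  - eapply tangle_push; eauto. apply C.
  - apply C.
  - eapply ray_move; eauto. apply C.
  - unfold push. rewrite !(pull_pull f g); auto. apply C.
  - eapply endo_move; eauto. apply C.
  - eapply ord_pull; eauto. apply C.
  - intros D E m HT HE HO. apply (cut_least _ _ _ _ _ _ C (pull f D) (pull f E)); auto.
    + eapply endo_pull; eauto.
    + eapply ord_pull; eauto.
Qed.

Lemma push_push f g tau : auto_pair f g -> push g (push f tau) = tau.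
Proof.
  intros H. apply functional_extensionality; intros A.
  apply functional_extensionality; intros B. unfold push.
  rewrite !(pull_pull f g); auto.
Qed.

Lemma mincut_push f g k tau r n A B : auto_pair f g -> mincut k tau r n A B ->
  mincut k (push f tau) (move f r) n (pull g A) (pull g B).
Proof.
  intros H [C M]. assert (H' := auto_pair_sym _ _ H).
  split; [eapply cut_push; eauto|]. intros D E HD S1 S2.
  apply (cut_push g f) in HD; auto.
  rewrite (push_push f g), (move_move f g) in HD; auto.
  assert (F : forall x, f (g x) = x) by apply H.
  destruct (M _ _ HD) as [M1 M2].
  - intros x Hx. apply S1 in Hx. unfold pull in Hx. rewrite (proj1 H) in Hx; auto.
  - intros x Hx. apply S2. unfold pull. rewrite (proj1 H); auto.
  - split; intros x Hx.
    + apply M1 in Hx. unfold pull in Hx. rewrite F in Hx; auto.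
    + apply M2. unfold pull. rewrite F; auto.
Qed.

Lemma mincut_end_eq k tau r r' n A B : end_eq r r' -> ray V adj r' ->
  mincut k tau r n A B -> mincut k tau r' n A B.
Proof.
  assert (G : forall r r' A B, end_eq r r' -> ray V adj r' ->
    cut k tau r n A B -> cut k tau r' n A B).
  { intros r1 r2 C D E R H. constructor; try apply H; auto.
    - apply E, H.
    - intros C' D' m HT HE. apply (cut_least _ _ _ _ _ _ H); auto. apply E; auto. }
  intros E R [C M]. split; [eapply G; eauto|].
  intros C' D' H. apply M. apply (G r' r); auto; [|apply C].
  intros X Y; symmetry; apply E.
Qed.

Lemma end_eq_move f g r r' : auto_pair f g -> end_eq r r' -> end_eq (move f r) (move f r').
Proof.
  assert (G : forall r r' A B, auto_pair f g -> end_eq r r' ->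
    endo (move f r) A B -> endo (move f r') A B).
  { intros r1 r2 A B H E X. apply (endo_pull f g) in X; auto. apply E in X.
    apply (endo_move f g) in X; auto.
    rewrite !(pull_pull g f) in X; auto using auto_pair_sym. }
  intros H E A B; split; apply G; auto. intros X Y; symmetry; apply E.
Qed.

Lemma end_eq_sym r r' : end_eq r r' -> end_eq r' r.
Proof. intros E A B; symmetry; apply E. Qed.

Lemma end_eq_trans r r' r'' : end_eq r r' -> end_eq r' r'' -> end_eq r r''.
Proof. intros E E' A B. rewrite (E A B); apply E'. Qed.

(** * Boundedness for tangles and ends *)

Definition ends_separated (K : nat) : Prop :=
  forall r r', ray V adj r -> ray V adj r' -> ~ end_eq r r' ->
    exists A B, ord A B K /\ endo r A B /\ endo r' B A.

(** The tangle is forgotten, so that separations arising from different tangles can be compared when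
    they share the end. Order above [K] makes each tangle involved orient separations of order at
    most [K] as the end does. *)
Definition nice (K : nat) (r : nat -> V) (n : nat) (A B : vset) : Prop :=
  K < n /\ exists k tau, mincut k tau r n A B.

Lemma nice_push f g K r n A B : auto_pair f g -> nice K r n A B ->
  nice K (move f r) n (pull g A) (pull g B).
Proof.
  intros H (HK & k & tau & M). split; auto.
  exists k, (push f tau). eapply mincut_push; eauto.
Qed.

Lemma nice_end_eq K r r' n A B : end_eq r r' -> ray V adj r' -> nice K r n A B ->
  nice K r' n A B.
Proof.
  intros E R (HK & k & tau & M). split; auto. exists k, tau. eapply mincut_end_eq; eauto.
Qed.

Lemma nice_ray K r n A B : nice K r n A B -> ray V adj r.
Proof. intros (_ & k & tau & H & _). apply H. Qed.

Lemma ray_conn r : ray V adj r -> forall i, conn (r 0) (r i).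
Proof. intros R i. apply ray_reach; auto; [intros ? ? []|lia]. Qed.

(** A ray of the end itself is excluded by [(B, A)], any other ray by a separation of order at most
    [K]; [compactness] makes the family finite. *)
Lemma end_cover K r A B : ends_separated K -> ray V adj r -> endo r A B ->
  exists l F, (forall p, In p l ->
      (ord (fst p) (snd p) K /\ endo r (fst p) (snd p)) \/ p = (B, A)) /\
    forall x, conn (r 0) x -> interl l x -> In x F.
Proof.
  intros HK R E. apply compactness.
  - intros p [[O H]| ->]; simpl.
    + split; [eapply endo_sep; eauto|eapply endo_fin; eauto].
    + split; [apply sep_sym; eapply endo_sep; eauto|apply fin_sym; eapply endo_fin; eauto].
  - intros r' R' _. destruct (classic (end_eq r r')) as [Q|Q].
    + exists (B, A); split; auto. simpl. intros X. apply (endo_excl r' A B); auto. apply Q; auto.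
    + destruct (HK r r' R R' Q) as (C & D & O & H & H').
      exists (C, D); split; [left; auto|]. simpl. intros X. eapply endo_excl; eauto.
Qed.

Lemma end_cover_fin K r A B l : endo r A B ->
  (forall p, In p l -> (ord (fst p) (snd p) K /\ endo r (fst p) (snd p)) \/ p = (B, A)) ->
  forall p, In p l -> finite_order V (fst p) (snd p).
Proof.
  intros E Hl p Hp. destruct (Hl p Hp) as [[O _]| ->].
  - eapply ord_fin; eauto.
  - apply fin_sym. eapply endo_fin; eauto.
Qed.

Lemma cut_small k tau r n A B C D m : cut k tau r n A B -> m < n ->
  ord C D m -> endo r C D -> tau C D.
Proof.
  intros H Hm O E.
  destruct (tangle_total k tau C D m) as [|X]; auto.
  - apply H.
  - eapply endo_sep; eauto.
  - apply okn_le with n; [lia|apply H].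
  - assert (n <= m) by (eapply (cut_least _ _ _ _ _ _ H); eauto). lia.
Qed.

Lemma iter_pull_mono f i A : sub (pull f A) A -> sub (Nat.iter i (pull f) A) A.
Proof.
  intros H. induction i as [|i IH]; simpl; intros x Hx; auto. apply H. apply IH, Hx.
Qed.

Lemma iter_pull_mono' f i A : sub A (pull f A) -> sub A (Nat.iter i (pull f) A).
Proof.
  intros H. induction i as [|i IH]; simpl; intros x Hx; auto. apply IH, H, Hx.
Qed.

Lemma iter_pull_cancel f g i m A : auto_pair f g ->
  Nat.iter i (pull f) A = Nat.iter (i + m) (pull f) A -> A = Nat.iter m (pull f) A.
Proof.
  intros H. induction i as [|i IH]; simpl; auto. intros E. apply IH.
  apply (f_equal (pull g)) in E. rewrite !(pull_pull g f) in E; auto using auto_pair_sym.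
Qed.

(* The iterated translates of (A, B) are all nice and below (A, B), hence finitely many. *)
Lemma nice_no_descent f g K r n A B : ends_separated K -> nice K r n A B ->
  auto_pair f g -> end_eq (move f r) r -> sub (pull f A) A -> sub B (pull f B) ->
  sub A (pull f A) /\ sub (pull f B) B.
Proof.
  intros HK HN Hf Er SA SB. assert (R := nice_ray _ _ _ _ _ HN).
  assert (E : endo r A B) by (destruct HN as (_ & k & tau & H & _); apply H).
  assert (Er' : end_eq (move g r) r).
  { apply end_eq_sym. rewrite <- (move_move f g r Hf) at 1.
    eapply end_eq_move; eauto using auto_pair_sym. }
  destruct (end_cover K r A B HK R E) as (l & F & Hl & HF).
  destruct (proj2 (proj2 E)) as (m & Hm). destruct (Hm m (le_n m)) as [Bm _].
  destruct (cuts_finite (r 0) l F (r m) n) as [L HL]; auto using ray_conn.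
  { eapply end_cover_fin; eauto. }
  assert (HNi : forall i, nice K r n (Nat.iter i (pull f) A) (Nat.iter i (pull f) B)).
  { induction i as [|i IH]; simpl; auto.
    apply nice_end_eq with (move g r); auto. apply nice_push; auto using auto_pair_sym. }
  destruct (pigeonhole_nat _ (fun i => (Nat.iter i (pull f) A, Nat.iter i (pull f) B)) L)
    as (i & j & Hij & Eij).
  { intros i. destruct (HNi i) as (Kn & k & tau & M).
    assert (C := proj1 M).
    destruct (mincut_qsep _ _ _ _ _ _ (r 0) M) as (q & Cq & _ & _ & Qq).
    { eapply cut_lives; [exact C|lia]. }
    apply (HL k tau r _ _ q); auto.
    - apply iter_pull_mono'; auto.
    - intros p Hp. destruct (Hl p Hp) as [[O H]| ->].
      + left. eapply cut_small; eauto.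
      + right. simpl. apply iter_pull_mono; auto. }
  injection Eij as EA EB.
  (* After cancellation [A] is [pull f] of an iterate that lies inside [A], which gives the
     inclusion of [A] in [pull f A]. *)
  replace j with (i + S (j - S i)) in EA, EB by lia.
  apply (iter_pull_cancel f g) in EA; auto. apply (iter_pull_cancel f g) in EB; auto.
  simpl in EA, EB. split.
  - rewrite EA at 1. intros x Hx. unfold pull in *. apply (iter_pull_mono f) in Hx; auto.
  - rewrite EB at 2. intros x Hx. unfold pull in *. apply (iter_pull_mono' f); auto.
Qed.

(** The translate of [(A, B)] is nice for the same end, hence nested with [(A, B)]. Two of the three
    cases put [f x] into [B] at once; in the remaining one [nice_no_descent], applied to the
    inverse, makes the two coincide. *)
Lemma nice_boundary_orbit f g K r n A B x : ends_separated K -> nice K r n A B ->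
  auto_pair f g -> end_eq (move f r) r -> A x -> B x -> A (f x) -> ~ B (f x) -> False.
Proof.
  intros HK HN Hf Er Ax Bx Afx Bfx. assert (R := nice_ray _ _ _ _ _ HN).
  assert (Hg := auto_pair_sym _ _ Hf).
  assert (Er' : end_eq (move g r) r).
  { apply end_eq_sym. rewrite <- (move_move f g r Hf) at 1. eapply end_eq_move; eauto. }
  assert (HN' : nice K r n (pull f A) (pull f B)).
  { apply nice_end_eq with (move g r); auto. apply nice_push; auto. }
  assert (HN0 := HN). destruct HN0 as (_ & k & tau & M). destruct HN' as (_ & k' & tau' & M').
  destruct (mincut_nested _ _ _ _ _ _ _ _ _ _ _ M M' (le_n n)) as [[S1 S2]|[[S1 S2]|(_ & S1 & S2)]].
  - destruct (nice_no_descent g f K r n A B) as [S3 S4]; auto.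
    + intros y Hy. apply S1 in Hy. unfold pull in Hy. rewrite (proj1 Hg) in Hy; auto.
    + intros y Hy. apply S2. unfold pull. rewrite (proj1 Hg); auto.
    + apply Bfx. apply S4. unfold pull. rewrite (proj1 Hf); auto.
  - apply Bfx. apply (S1 x Ax).
  - apply Bfx. apply (S2 x Bx).
Qed.

(** * Finitely many orbits of boundary vertices *)

Definition zpair (K : nat) (w : V) (r : nat -> V) : Prop :=
  exists n A B, nice K r n A B /\ A w /\ B w.

Definition eff (r r' : nat -> V) (e : nat) (E F : vset) : Prop :=
  ord E F e /\ endo r E F /\ endo r' F E /\
  forall C D m, endo r C D -> endo r' D C -> ord C D m -> e <= m.

Lemma eff_sym r r' e E F : eff r r' e E F -> eff r' r e F E.
Proof.
  intros (O & H & H' & M). split; [apply ord_sym; auto|split; [auto|split; auto]].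
  intros C D m HC HD Om. apply (M D C); auto. apply ord_sym; auto.
Qed.

(** If both ends lie on the [B]-side, the corner [cap A F] is again a first side of a cut, so
    minimality puts [A], and with it [w], into [F]. Otherwise [(cap A E, cup B F)] still has order
    at most [e], and its second side contains [B]. The last clause keeps what an earlier application
    has gained. *)
Lemma eff_shift K k tau r r' n A B w e E F : mincut k tau r n A B -> K < n ->
  A w -> B w -> ray V adj r' -> e <= K -> eff r r' e E F ->
  exists E' F', eff r r' e E' F' /\ F' w /\ (E w -> E' w).
Proof.
  intros [H M] Kn Aw Bw R' eK (O & HE & HE' & Min).
  assert (HA := cut_endo _ _ _ _ _ _ H). assert (OA := cut_ord _ _ _ _ _ _ H).
  assert (SA := endo_sep _ _ _ HA). assert (SE := endo_sep _ _ _ HE).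
  assert (FA := endo_fin _ _ _ HA). assert (FE := endo_fin _ _ _ HE).
  destruct (endo_total r' A B R' SA FA) as [HB|HB].
  - exists E, F. split; [split; auto|]. split; auto.
    assert (Ocap : ord (cap A F) (cup B E) n).
    { destruct (submodular A B F E n e OA (ord_sym _ _ _ O)) as (p & q & Hpq & Op & Oq).
      assert (e <= p).
      { apply (Min (cap B E) (cup A F)); auto using ord_sym.
        - replace (cap B E) with (cap E B) by (apply vset_ext; unfold cap; tauto).
          replace (cup A F) with (cup F A) by (apply vset_ext; unfold cup; tauto).
          apply endo_cap; auto using sep_sym, fin_sym.
        - apply endo_cup; auto. }
      apply ord_mono with q; auto; lia. }
    destruct (M (cap A F) (cup B E)) as [M1 _].
    + apply cut_other with A B; auto.
      * apply (tangle_cup k tau B A E F n); auto using ord_sym; try apply H.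
        apply (cut_small k tau r n A B E F e); auto; lia.
      * apply endo_cap; auto using sep_sym, fin_sym.
    + intros x [? ?]; auto.
    + intros x; left; auto.
    + apply M1; auto.
  - exists (cap A E), (cup B F).
    assert (Ocap : ord (cap A E) (cup B F) e).
    { destruct (submodular A B E F n e OA O) as (p & q & Hpq & Op & Oq).
      assert (n <= p).
      { apply (cut_sup _ _ _ _ _ _ (cup A E) (cap B F) p H); auto.
        - apply endo_cup; auto.
        - intros x; left; auto. }
      apply ord_mono with q; auto; lia. }
    split; [split; [auto|split; [|split; auto]]|].
    + apply endo_cap; auto.
    + apply endo_cup; auto.
    + split; [left; auto|]. intros Ew; split; auto.
Qed.

Lemma zpair_separator K w r r' : ends_separated K -> zpair K w r -> zpair K w r' ->
  ~ end_eq r r' -> exists e E F, e <= K /\ eff r r' e E F /\ E w /\ F w.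
Proof.
  intros HK (n & A & B & HN & Aw & Bw) (n' & A' & B' & HN' & Aw' & Bw') N.
  assert (R := nice_ray _ _ _ _ _ HN). assert (R' := nice_ray _ _ _ _ _ HN').
  destruct (HK r r' R R' N) as (E0 & F0 & O0 & HE0 & HF0).
  destruct (least_nat (fun e => exists E F, ord E F e /\ endo r E F /\ endo r' F E))
    as (e & (E & F & O & HE & HF) & Min); [eauto 6|].
  assert (eK : e <= K) by (apply Min; eauto).
  assert (HEF : eff r r' e E F) by (split; [auto|split; [auto|split; auto]]; intros; apply Min; eauto).
  destruct HN as (Kn & k & tau & M), HN' as (Kn' & k' & tau' & M').
  destruct (eff_shift K _ _ _ r' _ _ _ w e E F M) as (E1 & F1 & H1 & Fw1 & _); auto.
  (* The second application, with the ends exchanged, puts [w] on the other side and keeps it on the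
     first. *)
  destruct (eff_shift K _ _ _ r _ _ _ w e F1 E1 M') as (F2 & E2 & H2 & Ew2 & Fw2);
    auto using eff_sym.
  exists e, E2, F2. auto using eff_sym.
Qed.

(** Two different ends are separated efficiently by a tight separator through [w], and a neighbour
    of [w] names the component with the tail of one of them. So an end is determined by which sets
    [comp X y] contain its tail, for finitely many separators [X] and neighbours [y]. *)
Lemma zpair_ends_finite K w : ends_separated K -> exists L : list (nat -> V),
  (forall r, In r L -> zpair K w r) /\
  forall r, zpair K w r -> exists r', In r' L /\ end_eq r' r.
Proof.
  intros HK. destruct (tight_separators_finite w K) as [L HL]. destruct (loc_fin w) as [l Hl].
  apply (finite_classes (nat -> V) end_eq
    (map (fun p r => exists m, forall i, m <= i -> comp (fst p) (snd p) (r i)) (list_prod L l))).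
  intros r r' Z Z' Heq. apply NNPP; intros N.
  destruct (zpair_separator K w r r' HK Z Z' N) as (e & E & F & eK & HEF & Ew & Fw).
  assert (HFE := eff_sym _ _ _ _ _ HEF).
  destruct Z as (? & ? & ? & HN & _), Z' as (? & ? & ? & HN' & _).
  assert (R := nice_ray _ _ _ _ _ HN). assert (R' := nice_ray _ _ _ _ _ HN').
  destruct HEF as (O & HE & HF & Min). destruct HFE as (O' & HE' & HF' & Min').
  assert (SE := endo_sep _ _ _ HE).
  destruct (ray_side_full r E F e) as (m & Fm & Em & FS & Rm); auto.
  { intros C D i HC S S' Oi. apply (Min C D); auto.
    apply endo_mono with F E; auto.
    - apply sep_sym; eapply endo_sep; eauto.
    - apply fin_sym; eapply endo_fin; eauto. }
  destruct (ray_side_full r' F E e) as (m' & Em' & Fm' & FS' & Rm'); auto.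
  { intros C D i HC S S' Oi. apply (Min' C D); auto.
    apply endo_mono with E F; auto.
    - apply sep_sym; eapply endo_sep; eauto.
    - apply fin_sym; eapply endo_fin; eauto. }
  replace (cap F E) with (cap E F) in * by (apply vset_ext; unfold cap; tauto).
  set (X := cap E F) in *.
  assert (NX : ~ comp X (r m) (r' m')).
  { intros C. apply Fm'. apply (reach_side F E (r m)); auto using sep_sym.
    replace (cap F E) with X by (apply vset_ext; unfold X, cap; tauto). exact C. }
  assert (HX : In X L).
  { apply HL; [split; auto| |exists (r m), (r' m'); auto].
    apply (ord_mono _ _ e K) in O; auto. apply card_ord; auto. }
  destruct (proj2 FS w) as (y & Ey & Ry); [split; auto|].
  destruct (Heq (fun s => exists m, forall i, m <= i -> comp X y (s i))) as [G _].
  { apply in_map_iff. exists (X, y); split; auto. apply in_prod; auto. }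
  destruct G as [j Hj].
  { exists m. intros i Hi. rewrite (comp_eq _ _ _ Ry); auto. }
  apply NX. rewrite <- (comp_eq _ _ _ Ry).
  apply reach_trans with (r' (j + m')); [apply Hj; lia|].
  apply reach_sym, Rm'; lia.
Qed.

Lemma zpair_orbits_finite K : ends_separated K -> quasi_transitive adj ->
  exists L : list (V * (nat -> V)), (forall p, In p L -> ray V adj (snd p)) /\
    forall w r, zpair K w r -> exists p f g, In p L /\ auto_pair f g /\
      f (fst p) = w /\ end_eq (move f (snd p)) r.
Proof.
  intros HK [reps Hreps].
  assert (G : exists L : list (V * (nat -> V)), (forall p, In p L -> ray V adj (snd p)) /\
    forall v r, In v reps -> zpair K v r -> exists p, In p L /\ fst p = v /\ end_eq (snd p) r).
  { clear Hreps. induction reps as [|v reps (L & HL1 & HL2)].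
    - exists []. split; simpl; tauto.
    - destruct (zpair_ends_finite K v HK) as (Lv & H1 & H2).
      exists (map (fun r => (v, r)) Lv ++ L). split.
      + intros p Hp. apply in_app_or in Hp as [Hp|Hp]; auto.
        apply in_map_iff in Hp as (r & <- & Hr). apply H1 in Hr.
        destruct Hr as (? & ? & ? & HN & _). eapply nice_ray; eauto.
      + intros u r [<-|Hu] Z.
        * destruct (H2 r Z) as (r' & Hr' & E). exists (v, r'). split; auto.
          apply in_or_app; left. apply in_map_iff; eauto.
        * destruct (HL2 u r Hu Z) as (p & Hp & ? & ?). exists p. split; auto.
          apply in_or_app; auto. }
  destruct G as (L & H1 & H2). exists L. split; auto.
  intros w r Z. destruct (Hreps w) as (v & Hv & f & [(g & Hg1 & Hg2) Hf] & Efv).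
  assert (Hfg : auto_pair f g) by (split; auto).
  destruct (H2 v (move g r) Hv) as (p & Hp & Ep & Er).
  { destruct Z as (n & A & B & HN & Aw & Bw).
    exists n, (pull f A), (pull f B). split; [apply nice_push; auto using auto_pair_sym|].
    unfold pull. rewrite Efv; auto. }
  exists p, f, g. split; auto. split; auto. split; [rewrite Ep; auto|].
  rewrite <- (move_move g f r); auto using auto_pair_sym. eapply end_eq_move; eauto.
Qed.

(** * A common bound on the orders of minimal separations between tangles and ends *)

Lemma nice_pos_order K r n A B : nice K r n A B -> exists x, A x /\ B x.
Proof.
  intros (Kn & k & tau & [H _]). apply NNPP; intros N.
  assert (n <= 0); [|lia]. apply (cut_least _ _ _ _ _ _ H A B); try apply H.
  exists []. split; auto. intros x Ax Bx. apply N; eauto.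
Qed.

Lemma nice_qsep K r n A B : nice K r n A B -> exists q, A q /\ ~ B q /\ qsep A B q.
Proof.
  intros (Kn & k & tau & M).
  destruct (mincut_qsep _ _ _ _ _ _ (r 0) M) as (q & _ & H); eauto.
  eapply cut_lives; [apply M|lia].
Qed.

(** The inside of [A2] is connected and contains [y]; a path in it leaving the inside of [A1] would
    pass a boundary vertex of [A1], which lies in [B2]. So it stays inside [A1], and the boundary
    vertices of [A2], each with a neighbour there, are boundary vertices of [A1]. *)
Lemma nice_chain_equal K r n1 n2 A1 B1 A2 B2 y : nice K r n1 A1 B1 -> nice K r n2 A2 B2 ->
  sub A1 A2 -> sub B2 B1 -> A1 y -> ~ B1 y -> (forall z, A1 z -> B1 z -> B2 z) -> n2 <= n1.
Proof.
  intros H1 H2 SA SB Ay By HX.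
  destruct (nice_qsep _ _ _ _ _ H2) as (q & _ & _ & EA & EB & F).
  assert (S1 : sep A1 B1) by (destruct H1 as (_ & ? & ? & C & _); exact (endo_sep _ _ _ (cut_endo _ _ _ _ _ _ C))).
  set (X := cap A2 B2) in *.
  assert (Qy : comp X q y).
  { apply NNPP; intros N. apply By, SB. rewrite EB. exact N. }
  assert (HQ : forall x, comp X q x -> A1 x /\ ~ B1 x).
  { intros x Hx. rewrite <- (comp_eq X q y Qy) in Hx. apply reach_strengthen in Hx.
    apply (reach_stable _ (fun x => A1 x /\ ~ B1 x) _ _ Hx); auto.
    intros u u' Cu Cu' [Au Bu] E. assert (Au' : A1 u') by (eapply sep_nbr; eauto).
    split; auto. intros Bu'. specialize (HX u' Au' Bu'). rewrite EB in HX. apply HX.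
    rewrite <- (comp_eq X q y Qy); auto. }
  destruct H1 as (_ & ? & ? & C1 & _), H2 as (_ & ? & ? & C2 & _).
  apply (cut_least _ _ _ _ _ _ C2 A2 B2); try apply C2.
  destruct (cut_ord _ _ _ _ _ _ C1) as (l & Hl & Hin). exists l. split; auto.
  intros z Az Bz. destruct (proj2 F z) as (y' & E & Hy'); [split; auto|].
  apply Hin; auto. destruct (HQ y' Hy'). eapply sep_nbr; eauto.
Qed.

(* Among nice separations with one end r, a common boundary vertex, a common inner
   vertex and the same orbits of boundary vertices inside, two of different orders
   would be nested with the inner one having its boundary on the outer boundary. *)
Lemma nice_bounded K : ends_separated K -> quasi_transitive adj ->
  exists N, forall r n A B, nice K r n A B -> n <= N.
Proof.
  intros HK HQ. apply NNPP; intros N.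
  destruct (zpair_orbits_finite K HK HQ) as (L & HLray & HL).
  assert (U0 : unbounded ((nat -> V) * nat * vset * vset) (fun t => snd (fst (fst t)))
    (fun t => let '(r, n, A, B) := t in nice K r n A B)).
  { intros b. apply NNPP; intros X. apply N. exists b. intros r n A B H.
    destruct (le_lt_dec n b); auto. exfalso. apply X. exists (r, n, A, B); auto. }
  destruct (unbounded_pick _ (V * (nat -> V)) _ _ L
    (fun p t => let '(r, n, A, B) := t in exists f g, auto_pair f g /\
       A (f (fst p)) /\ B (f (fst p)) /\ end_eq (move f (snd p)) r) U0)
    as ([v rho] & Hp & U1).
  { intros [[[r n] A] B] HN. destruct (nice_pos_order _ _ _ _ _ HN) as (x & Ax & Bx).
    destruct (HL x r) as (p & f & g & Hp & Hfg & Ex & Er); [exists n, A, B; auto|].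
    exists p. split; auto. exists f, g. rewrite Ex; auto. }
  assert (Rrho : ray V adj rho) by (apply (HLray (v, rho)); auto).
  (* Translation by the inverse automorphisms makes one boundary vertex [v] and one end [rho] common
     to all. *)
  assert (U2 : unbounded (nat * vset * vset) (fun t => fst (fst t))
    (fun t => let '(n, A, B) := t in nice K rho n A B /\ A v /\ B v)).
  { intros b. destruct (U1 b) as ([[[r n] A] B] & [HN (f & g & Hfg & Av & Bv & Er)] & Hn).
    simpl in *. exists (n, pull f A, pull f B). split; auto. split; [|split; auto].
    apply nice_end_eq with (move g r); auto.
    - rewrite <- (move_move f g rho Hfg). apply end_eq_sym.
      eapply end_eq_move; eauto using auto_pair_sym.
    - apply nice_push; auto using auto_pair_sym. }
  destruct (loc_fin v) as [nb Hnb].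
  destruct (unbounded_pick _ V _ _ nb (fun y t => let '(n, A, B) := t in A y /\ ~ B y) U2)
    as (y & Hy & U3).
  { intros [[n A] B] (HN & Av & Bv).
    destruct (nice_qsep _ _ _ _ _ HN) as (q & _ & _ & EA & EB & F).
    destruct (proj2 F v) as (y & Ey & Hy); [split; auto|].
    exists y. split; auto. split; [rewrite EA; left; auto|]. rewrite EB. intros X; apply X; auto. }
  (* For each orbit in [L], fix whether some pair in it with end [rho] has its vertex strictly
     inside [A]. *)
  destruct (unbounded_uniform _ _ (map (fun p t => let '(n, A, B) := t : nat * vset * vset in
    exists f g, auto_pair f g /\ A (f (fst p)) /\ ~ B (f (fst p)) /\
      end_eq (move f (snd p)) rho) L) _ U3) as (P & UP & HP & Huni).
  destruct (UP 0) as ([[n1 A1] B1] & P1 & _). destruct (UP n1) as ([[n2 A2] B2] & P2 & Hn).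
  simpl in Hn.
  destruct (HP _ P1) as [(HN1 & _ & _) [Ay1 By1]].
  destruct (HP _ P2) as [(HN2 & _ & _) [Ay2 By2]].
  assert (Hle : sub A1 A2 /\ sub B2 B1).
  { assert (HN1' := HN1). assert (HN2' := HN2).
    destruct HN1' as (_ & ? & ? & M1), HN2' as (_ & ? & ? & M2).
    destruct (mincut_nested _ _ _ _ _ _ _ _ _ _ _ M1 M2) as [?|[[S _]|[E _]]];
      [lia|auto| |lia].
    exfalso. apply By2, S, Ay1. }
  destruct Hle as [SA SB].
  assert (n2 <= n1); [|lia].
  apply (nice_chain_equal K rho n1 n2 A1 B1 A2 B2 y); auto.
  intros z Az Bz. apply NNPP; intros Bz2.
  (* As [z] is strictly inside [A2], uniformity places a vertex of its orbit strictly inside [A1],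
     reached from [z] by an automorphism that fixes the end. *)
  destruct (HL z rho) as (p & f & g & Hpp & Hfg & Ez & Er); [exists n1, A1, B1; auto|].
  destruct (Huni (fun t => let '(n, A, B) := t in
    exists f g, auto_pair f g /\ A (f (fst p)) /\ ~ B (f (fst p)) /\
      end_eq (move f (snd p)) rho) (n2, A2, B2) (n1, A1, B1))
    as (f' & g' & Hfg' & Az' & Bz' & Er'); auto.
  { apply in_map_iff. exists p; auto. }
  { exists f, g. rewrite Ez. auto. }
  assert (Ep : g z = fst p) by (rewrite <- Ez; apply Hfg).
  apply (nice_boundary_orbit (fun x => f' (g x)) (fun x => f (g' x)) K rho n1 A1 B1 z); auto.
  - apply (auto_pair_comp g f f' g'); auto using auto_pair_sym.
  - apply end_eq_trans with (move f' (snd p)); auto.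
    change (end_eq (move f' (move g rho)) (move f' (snd p))).
    apply (end_eq_move f' g'); auto.
    rewrite <- (move_move f g (snd p) Hfg). apply end_eq_sym.
    eapply end_eq_move; eauto using auto_pair_sym.
  - rewrite Ep; auto.
  - rewrite Ep; auto.
Qed.

Lemma tangle_end_bounded K : ends_separated K -> quasi_transitive adj ->
  exists N, forall k tau r C D, k_tangle V adj k tau -> ray V adj r -> tau D C -> endo r C D ->
    exists C' D', ord C' D' N /\ tau D' C' /\ endo r C' D'.
Proof.
  (* An order above [K + N] is above [K], which makes the minimal cut nice, and above [N], which no
     nice cut attains. *)
  intros HK HQ. destruct (nice_bounded K HK HQ) as [N HN]. exists (K + N).
  intros k tau r C D T R HT HE.
  destruct (least_nat (fun n => exists C D, ord C D n /\ tau D C /\ endo r C D))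
    as (n & (A & B & O & HA & HB) & Min).
  { destruct (fin_ord C D) as [n O]; [eapply endo_fin; eauto|eauto 6]. }
  destruct (le_lt_dec n (K + N)) as [L|L].
  { exists A, B. split; auto. apply ord_mono with n; auto. }
  assert (Cut : cut k tau r n A B).
  { constructor; auto.
    - assert (HS : in_S V adj k B A) by (destruct T as (_ & T & _); auto).
      destruct (okn_in_S _ _ _ HS) as (m & Om & Hm).
      apply okn_le with m; auto. apply Min. exists A, B; auto using ord_sym.
    - intros C' D' m ? ? ?. apply Min; eauto. }
  destruct (end_cover K r A B HK R HB) as (l & F & Hl & HF).
  destruct (proj2 (proj2 HB)) as (m & Hm). destruct (Hm m (le_n m)) as [Bm _].
  destruct (mincut_exists (r 0) l F (r m) k tau r n A B) as (A' & B' & M);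
    auto using ray_conn.
  - eapply cut_lives; eauto; lia.
  - eapply end_cover_fin; eauto.
  - intros p Hp. destruct (Hl p Hp) as [[Op Ep]| ->].
    + left. apply (cut_small k tau r n A B _ _ K); auto. lia.
    + right. simpl. intros x Hx; auto.
  - assert (nice K r n A' B') by (split; [lia|eauto]).
    assert (n <= N) by eauto. lia.
Qed.

(** * Boundedness for tangles separated from all ends *)

Definition covered (a : nat) (tau : orient_set V) (v : V) : Prop :=
  forall r, ray V adj r -> (forall i, conn v (r i)) ->
    exists C D, ord C D a /\ tau C D /\ endo r D C.

Lemma covered_push f g a tau v : auto_pair f g -> covered a tau v ->
  covered a (push f tau) (f v).
Proof.
  intros H Hc r R Cr. assert (Hg := auto_pair_sym _ _ H).
  destruct (Hc (move g r)) as (C & D & O & T & E).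
  - eapply ray_move; eauto.
  - intros i. specialize (Cr i). apply (conn_move g f) in Cr; auto.
    rewrite (proj1 H) in Cr; auto.
  - exists (pull g C), (pull g D). split; [eapply ord_pull; eauto|split].
    + unfold push. rewrite !(pull_pull f g); auto.
    + rewrite <- (move_move g f r); auto. eapply endo_move; eauto.
Qed.

Lemma covered_cover k a tau v : k_tangle V adj k tau -> covered a tau v ->
  exists l F, (forall p, In p l -> tau (fst p) (snd p) /\ ord (fst p) (snd p) a) /\
    forall x, conn v x -> interl l x -> In x F.
Proof.
  intros T Hc. apply (compactness v (fun p => tau (fst p) (snd p) /\ ord (fst p) (snd p) a)).
  - intros p [Hp O]. split; [eapply tangle_sep; eauto|eapply ord_fin; eauto].
  - intros r R Cr. destruct (Hc r R Cr) as (C & D & O & HT & E).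
    exists (C, D). simpl. split; auto. intros X. eapply endo_excl; eauto.
Qed.

(** The first sides in [l] and the complement of [conn v] have a small union, and the finite
    remainder is small too; the two would cover the graph. The successor counts the extra separation
    at [conn v]. *)
Lemma cover_bounds_order k a tau v l F : k_tangle V adj k tau -> lives tau v ->
  (forall p, In p l -> tau (fst p) (snd p) /\ ord (fst p) (snd p) a) ->
  (forall x, conn v x -> interl l x -> In x F) ->
  ~ okn k (S (length l) * a + length F).
Proof.
  intros T L Hl HF Hk. set (l' := (co (conn v), conn v) :: l).
  assert (TU : tau (unionl l') (interl l')).
  { apply (tangle_unionl_order k tau l' a); auto.
    - apply okn_le with (S (length l) * a + length F); auto. simpl; lia.
    - intros p [<-|Hp]; auto. split; auto. apply ord_conn. }
  assert (TI : tau (interl l') full).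
  { apply (tangle_small k tau _ (length F)); auto.
    - exists F. split; auto. intros x Hx. unfold l' in Hx. rewrite interl_cons in Hx.
      apply HF; apply Hx.
    - apply okn_le with (S (length l) * a + length F); auto. lia. }
  assert (SU := tangle_sep _ _ _ _ T TU).
  apply (tangle_no_cover2 k tau _ _ _ _ T TU TI); [apply SU|].
  intros; eapply sep_edge; eauto.
Qed.

(** Leastness for [tau] and [r] gives the union corner order at least [a], so the corner at
    [cap A E] has order at most [a] and is a cut for [tau'] and [r']; minimality there gives the
    inclusion. *)
Lemma mincut_absorbs k tau r k' tau' r' a A B E F : cut k tau r a A B ->
  mincut k' tau' r' a A B -> sep E F -> ord E F a -> endo r E F -> tau' F E -> sub A E.
Proof.
  intros H [H' M'] SE O HE HT.
  destruct (submodular A B E F a a (cut_ord _ _ _ _ _ _ H) O) as (p & q & Hpq & Op & Oq).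
  assert (a <= p).
  { apply (cut_sup _ _ _ _ _ _ (cup A E) (cap B F) p H); auto.
    - apply endo_cup; auto. apply H.
    - intros x; left; auto. }
  assert (Oa : ord (cap A E) (cup B F) a) by (apply ord_mono with q; auto; lia).
  destruct (M' (cap A E) (cup B F)) as [S1 _].
  - apply cut_other with A B; auto.
    + apply (tangle_cup k' tau' B A F E a); auto using ord_sym; apply H'.
    + apply endo_cap; auto; [apply H'|eapply ord_fin; eauto].
  - intros x [? ?]; auto.
  - intros x; left; auto.
  - intros x Ax. apply S1; auto.
Qed.

Lemma cut_not_sub k tau r a A B E F : cut k tau r a A B -> tau E F -> ~ sub A E.
Proof.
  intros H HT S. assert (SA := endo_sep _ _ _ (cut_endo _ _ _ _ _ _ H)).
  apply (tangle_no_cover2 k tau B A E F); auto.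
  - apply H.
  - apply H.
  - intros x. destruct SA as [SA _]. destruct (SA x); auto.
  - intros x y Exy. apply (sep_edge A B) in Exy; auto.
    destruct Exy as [[Ax Ay]|]; auto.
Qed.

(** If [tau'] disagreed, [mincut_absorbs] would put [A] inside [E] or inside [F], depending on the
    side of the end. In each case this is the small side for one of the tangles, which [cut_not_sub]
    forbids. *)
Lemma mincut_agree k tau r k' tau' r' a A B E F :
  mincut k tau r a A B -> mincut k' tau' r' a A B -> ord E F a -> tau E F -> tau' E F.
Proof.
  intros M M' O HT. assert (H := proj1 M). assert (H' := proj1 M').
  assert (SE := tangle_sep _ _ _ _ (cut_tangle _ _ _ _ _ _ H) HT).
  destruct (tangle_total k' tau' E F a) as [|HT']; auto; try apply H'.
  exfalso. destruct (endo_total r E F) as [HE|HE]; auto.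
  - apply H.
  - eapply ord_fin; eauto.
  - apply (cut_not_sub _ _ _ _ _ _ E F H HT).
    apply (mincut_absorbs k tau r k' tau' r' a A B E F); auto.
  - apply (cut_not_sub _ _ _ _ _ _ F E H' HT').
    apply (mincut_absorbs k tau r k tau r a A B F E); auto using sep_sym, ord_sym.
Qed.

(** The finite cover found for one tangle consists of separations of order at most [a]. By
    [mincut_agree] every other tangle with this minimal cut contains it, so one bound serves all. *)
Lemma mincut_order_bounded a A B : exists M, forall k tau r v, okn k M ->
  mincut k tau r a A B -> lives tau v -> covered a tau v -> False.
Proof.
  destruct (classic (exists k tau r v, mincut k tau r a A B /\ lives tau v /\ covered a tau v))
    as [(k & tau & r & v & M & L & C)|N].
  - destruct (covered_cover k a tau v) as (l & F & Hl & HF); auto; [apply M|].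
    exists (S (length l) * a + length F). intros k' tau' r' _ Hk M' _ _. revert Hk.
    apply (cover_bounds_order k' a tau' v l F); auto.
    + apply M'.
    + apply (mincut_agree _ _ _ _ _ _ _ _ _ _ _ M M'); auto. apply ord_conn.
    + intros p Hp. destruct (Hl p Hp) as [HT O]. split; auto.
      apply (mincut_agree _ _ _ _ _ _ _ _ _ _ _ M M'); auto.
  - exists 0. intros k tau r v _ M L C. apply N. eauto 8.
Qed.

(* The level a is the largest order needed to separate the tangle from some end. *)
Lemma covered_mincut k tau v b r0 : k_tangle V adj k tau -> okn k b -> lives tau v ->
  covered b tau v -> ray V adj r0 -> (forall i, conn v (r0 i)) ->
  exists a r A B x, a <= b /\ mincut k tau r a A B /\ covered a tau v /\ A x /\ B x.
Proof.
  intros T Hk L Hc R0 C0.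
  set (P := fun a => exists r C D, ray V adj r /\ (forall i, conn v (r i)) /\
    ord C D a /\ tau D C /\ endo r C D /\
    forall C D m, tau D C -> endo r C D -> ord C D m -> a <= m).
  assert (Hr : forall r, ray V adj r -> (forall i, conn v (r i)) ->
    exists a, P a /\ exists C D, ord C D a /\ tau C D /\ endo r D C).
  { intros r R C. destruct (least_nat (fun n => exists C D, ord C D n /\ tau C D /\ endo r D C))
      as (a & (A & B & O & HT & E) & Min).
    - destruct (Hc r R C) as (A & B & H). eauto.
    - exists a. split; [|eauto]. exists r, B, A.
      split; [auto|split; [auto|split; [apply ord_sym; auto|split; [auto|split; [auto|]]]]].
      intros C' D' m HT' E' O'. apply Min. exists D', C'; auto using ord_sym. }
  destruct (greatest_nat P b) as (a & (r & A & B & R & Cr & O & HT & E & Min) & Max).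
  - destruct (Hr r0 R0 C0) as (a & Pa & _); eauto.
  - intros a (r & A & B & R & Cr & O & HT & E & Min).
    destruct (Hc r R Cr) as (C & D & O' & HT' & E'). eapply Min; eauto using ord_sym.
  - assert (ab : a <= b).
    { destruct (Hc r R Cr) as (C & D & O' & HT' & E'). eapply Min; eauto using ord_sym. }
    assert (Hca : covered a tau v).
    { intros r' R' C'. destruct (Hr r' R' C') as (a' & Pa' & C & D & O' & HT' & E').
      exists C, D. split; auto. apply ord_mono with a'; auto. }
    destruct (covered_cover k a tau v T Hca) as (l & F & Hl & HF).
    destruct (proj2 (proj2 E)) as (m & Hm). destruct (Hm m (le_n m)) as [Bm Am].
    destruct (mincut_exists v l F (r m) k tau r a A B) as (A' & B' & M); auto.
    + constructor; auto. apply okn_le with b; auto.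
    + intros p Hp. eapply ord_fin, Hl; auto.
    + intros p Hp. left. apply Hl; auto.
    (* With an empty boundary, a path within [conn v] from [q] to the ray would stay on the
       [A']-side. *)
    + assert (X : exists x, A' x /\ B' x).
      { apply NNPP; intros N.
        destruct (mincut_qsep _ _ _ _ _ _ v M L) as (q & Cq & Aq & Bq & _).
        assert (E' := cut_endo _ _ _ _ _ _ (proj1 M)).
        destruct (proj2 (proj2 E')) as (i & Hi).
        destruct (Hi i (le_n i)) as [_ Ni]. apply Ni.
        apply (reach_side A' B' q); auto.
        - eapply endo_sep; eauto.
        - assert (Q : conn q (r i)) by (rewrite (conn_eq v q); auto).
          eapply reach_mono; [|exact Q]. intros y _ [Ay By]. apply N; eauto. }
      destruct X as (x & Ax & Bx). exists a, r, A', B', x. auto.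
Qed.

Lemma tangle_order_bounded b : quasi_transitive adj ->
  exists M, forall k tau v, k_tangle V adj k tau -> okn k M -> lives tau v ->
    covered b tau v -> False.
Proof.
  intros [reps Hreps].
  (* Collects the possible minimal cuts of order up to [b] with a representative vertex in their
     boundary. *)
  destruct (list_choice V (vset * vset) reps (fun w p => fst p w /\ snd p w /\
    ord (fst p) (snd p) b /\ (exists q, qsep (fst p) (snd p) q) /\ tight (cap (fst p) (snd p))))
    as [L HL].
  { intros w _. destruct (qseps_finite w b) as [L HL]. exists L.
    intros [A B] (? & ? & ? & (q & ?) & ?). eapply HL; eauto. }
  destruct (list_bound ((vset * vset) * nat) (list_prod L (seq 0 (S b)))
    (fun s M => forall k tau r v, okn k M -> mincut k tau r (snd s) (fst (fst s)) (snd (fst s)) ->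
      lives tau v -> covered (snd s) tau v -> False)) as [M1 HM1].
  { intros s m n Hmn H k tau r v Hk. apply (H k tau r v). apply okn_le with n; auto. }
  { intros [[A B] a] _. apply mincut_order_bounded. }
  destruct (list_bound V reps (fun w M => (forall r, ray V adj r -> (forall i, conn w (r i)) -> False) ->
    forall k tau, k_tangle V adj k tau -> okn k M -> lives tau w -> False)) as [M2 HM2].
  { intros w m n Hmn H Hw k tau T Hk. apply (H Hw k tau T). apply okn_le with n; auto. }
  { intros w _. destruct (classic (forall r, ray V adj r -> (forall i, conn w (r i)) -> False))
      as [Hw|]; [|exists 0; tauto].
    (* A component without rays is finite: the empty family already leaves only [F]. *)
    destruct (compactness w (fun _ => False)) as (l & F & Hl & HF); [tauto| |].
    { intros r R C. destruct (Hw r R C). }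
    exists (S (length l) * 0 + length F). intros _ k tau T Hk Lw. revert Hk.
    apply (cover_bounds_order k 0 tau w l F); auto.
    intros p Hp. destruct (Hl p Hp). }
  (* [M1] serves components with a ray, [M2] those without, and [b] lets the tangle orient the cuts
     found by [covered_mincut]. *)
  exists (M1 + M2 + b). intros k tau v T Hk Lv Hc.
  destruct (classic (exists r, ray V adj r /\ forall i, conn v (r i))) as [(r0 & R0 & C0)|N].
  - destruct (covered_mincut k tau v b r0) as (a & r & A & B & x & ab & M & Hca & Ax & Bx); auto.
    { apply okn_le with (M1 + M2 + b); auto. lia. }
    destruct (Hreps x) as (w & Hw & f & [(g & Hg1 & Hg2) Hf] & Ew).
    assert (Hfg : auto_pair f g) by (split; auto). assert (Hgf := auto_pair_sym _ _ Hfg).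
    assert (M' := mincut_push g f _ _ _ _ _ _ Hgf M).
    assert (L' := lives_push g f tau v Hgf Lv).
    apply (HM1 ((pull f A, pull f B), a)) with (k := k) (tau := push g tau) (r := move g r)
      (v := g v); auto.
    + apply in_prod; [|apply in_seq; lia]. apply (HL w); auto. simpl.
      destruct (mincut_qsep _ _ _ _ _ _ _ M' L') as (q & _ & _ & _ & Qq).
      split; [unfold pull; rewrite Ew; auto|split; [unfold pull; rewrite Ew; auto|]].
      split; [apply ord_mono with a; auto; apply M'|split; eauto].
      eapply cut_tight; [apply M'|eauto].
    + apply okn_le with (M1 + M2 + b); auto. lia.
    + apply (covered_push g f); auto.
  - destruct (Hreps v) as (w & Hw & f & [(g & Hg1 & Hg2) Hf] & Ew).
    assert (Hfg : auto_pair f g) by (split; auto). assert (Hgf := auto_pair_sym _ _ Hfg).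
    apply (HM2 w Hw) with (k := k) (tau := push g tau).
    + intros r R C. apply N. exists (move f r). split; [eapply ray_move; eauto|].
      intros i. rewrite <- Ew. eapply conn_move; eauto.
    + eapply tangle_push; eauto.
    + apply okn_le with (M1 + M2 + b); auto. lia.
    + rewrite <- (Hg1 w), Ew. apply (lives_push g f); auto.
Qed.

(** * Tangles living in no component *)

(* A tangle living in no component discards the finitely many components meeting the
   separator, and what remains is a separation of order 0. *)
Lemma homeless_tangles_agree k1 k2 tau1 tau2 A B :
  k_tangle V adj k1 tau1 -> k_tangle V adj k2 tau2 -> (forall v, ~ lives tau1 v) ->
  (forall C D, ord C D 0 -> tau1 C D -> tau2 C D) -> tau1 B A -> tau2 A B -> False.
Proof.
  intros T1 T2 NL Agree H1 H2.
  assert (S := tangle_sep _ _ _ _ T2 H2).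
  assert (HS : in_S V adj k1 B A) by (destruct T1 as (_ & T & _); auto).
  destruct (okn_in_S _ _ _ HS) as (n & (X & _ & HX) & Hn).
  assert (H0 : okn k1 0) by (apply okn_le with n; auto; lia).
  set (l := map (fun y => (conn y, co (conn y))) X).
  assert (Hl : forall p, In p l -> exists y, In y X /\ p = (conn y, co (conn y))).
  { intros p Hp. apply in_map_iff in Hp as (y & <- & Hy); eauto. }
  assert (TU1 : tau1 (unionl l) (interl l)).
  { apply (tangle_unionl k1 tau1 l 0); auto.
    - intros p Hp. destruct (Hl p Hp) as (y & _ & ->). simpl.
      destruct (tangle_total k1 tau1 (conn y) (co (conn y)) 0) as [|C]; auto.
      + apply sep_sym, sep_conn.
      + apply ord_sym, ord_conn.
      + destruct (NL y C).
    - intros l1 l2 E. exists []. split; auto. intros x (p & Hp & Ux) Ix.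
      destruct (Hl p) as (y & _ & Ep); [rewrite E; apply in_or_app; auto|].
      specialize (Ix p Hp). subst p. destruct (Ix Ux). }
  set (U := unionl l) in *.
  assert (TU2 : tau2 U (interl l)).
  { apply Agree; auto. exists []. split; auto. intros x (p & Hp & Ux) Ix.
    destruct (Hl p Hp) as (y & _ & Ep). specialize (Ix p Hp). subst p. destruct (Ix Ux). }
  assert (HU : forall x y, adj x y -> U x -> U y).
  { intros x y E (p & Hp & Ux). exists p. split; auto.
    destruct (Hl p Hp) as (z & _ & ->). eapply conn_nbr; eauto. }
  assert (HUX : forall x, A x -> B x -> U x).
  { intros x Ax Bx. exists (conn x, co (conn x)). split; [|apply conn_refl].
    apply in_map_iff. exists x; split; auto. }
  assert (Edge : forall x y, adj x y -> (A x /\ A y) \/ (B x /\ B y))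
    by (intros; eapply sep_edge; eauto).
  assert (Cover : forall x, A x \/ B x) by apply S.
  assert (Edge' : forall x y, adj x y -> (B x /\ B y) \/ (U x /\ U y) \/
    (cap A (co U) x /\ cap A (co U) y)).
  { intros x y E. assert (E' := adj_sym _ _ E). unfold cap, co.
    assert (G := HU x y E). assert (G' := HU y x E').
    destruct (Edge x y E), (classic (U x)); tauto. }
  (* [U] absorbs the boundary of [(A, B)], so the rest of [A] splits off with order 0, and [tau2]
     orients this separation as [tau1] does. *)
  assert (SE : sep (cap A (co U)) (cup B U)).
  { apply sep_of_edges; unfold cup; intros x.
    - unfold cap, co. destruct (Cover x), (classic (U x)); tauto.
    - intros y E. destruct (Edge' x y E); tauto. }
  assert (OE : ord (cap A (co U)) (cup B U) 0).
  { exists []. split; auto. intros x [Ax Nx] [Bx|Ux]; [|destruct (Nx Ux)].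
    destruct Nx; auto. }
  destruct (tangle_total k1 tau1 _ _ 0 T1 SE OE H0) as [HE|HE].
  - destruct T1 as (_ & _ & _ & _ & T1). apply (T1 _ _ _ _ _ _ H1 TU1 HE).
    split; auto. intros x. unfold cap, co. destruct (Cover x), (classic (U x)); tauto.
  - apply Agree in HE; [|apply ord_sym; auto].
    apply (tangle_no_cover2 k2 tau2 _ _ _ _ T2 H2 HE); unfold cup.
    + intros x. destruct (Cover x); auto.
    + intros x y E. destruct (Edge x y E); tauto.
Qed.

(** * Distinguishing two tangles with the help of an end *)

Lemma tangles_accessible : accessible adj -> quasi_transitive adj -> tangle_accessible adj.
Proof.
  intros [K HK] HQ.
  assert (HS : ends_separated K) by (intros r r'; apply accessible_separates; auto).
  destruct (tangle_end_bounded K HS HQ) as [N HN].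
  destruct (tangle_order_bounded N HQ) as [M HM].
  (* Above [M] the first tangle exceeds the bound of [tangle_order_bounded]; above [N] both tangles
     orient all separations of order at most [N], and in the same way. *)
  exists (M + N). intros tau1 tau2 [k1 T1] [k2 T2] (A0 & B0 & S0 & _ & H1 & H2).
  destruct (least_nat (fun n => exists A B, ord A B n /\ tau1 A B /\ tau2 B A))
    as (n & (A & B & O & HA & HB) & Min).
  { assert (X : in_S V adj k1 A0 B0) by (destruct T1 as (_ & T & _); auto).
    destruct (okn_in_S _ _ _ X) as (n & On & _). eauto 6. }
  destruct (le_lt_dec n (M + N)) as [Ln|Ln].
  { exists A, B. split; [apply ord_mono with n; auto|].
    split; [exact (tangle_sep _ _ _ _ T1 HA)|split; [|auto]].
    intros E. apply (vset_ext A B) in E. subst B. exact (tangle_excl _ _ _ _ T1 HA HA). }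
  exfalso.
  assert (Ok : forall k tau C D, k_tangle V adj k tau -> tau C D ->
    (forall m, ord C D m -> n <= m) -> okn k n).
  { intros k tau C D T H Hm. assert (X : in_S V adj k C D) by (destruct T as (_ & T & _); auto).
    destruct (okn_in_S _ _ _ X) as (m & Om & Hk). apply okn_le with m; auto. }
  assert (Ok1 : okn k1 n) by (apply (Ok k1 tau1 A B); auto; intros m Om; apply Min; eauto).
  assert (Ok2 : okn k2 n).
  { apply (Ok k2 tau2 B A); auto. intros m Om; apply Min. exists A, B; auto using ord_sym. }
  assert (Agree : forall C D m, m < n -> ord C D m -> tau1 C D -> tau2 C D).
  { intros C D m Hm Om H.
    destruct (tangle_total k2 tau2 C D m) as [|X]; auto.
    - eapply tangle_sep; [exact T1|auto].
    - apply okn_le with n; auto; lia.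
    - assert (n <= m) by (apply Min; eauto). lia. }
  assert (Hv : exists v, lives tau1 v).
  { apply NNPP; intros X. apply (homeless_tangles_agree k1 k2 tau1 tau2 B A); auto.
    - intros v Lv; eauto.
    - intros C D O0. apply (Agree C D 0); auto. lia. }
  destruct Hv as [v Lv].
  (* By the choice of [M], some end is not separated from the first tangle with order at most
     [N]. *)
  assert (Hr : exists r, ray V adj r /\ ~ exists C D, ord C D N /\ tau1 C D /\ endo r D C).
  { apply NNPP; intros X. apply (HM k1 tau1 v); auto.
    - apply okn_le with n; auto; lia.
    - intros r R _. apply NNPP; intros Y. apply X; eauto. }
  destruct Hr as (r & R & Far).
  assert (SA := tangle_sep _ _ _ _ T1 HA).
  (* If the end is on the side of [tau1], it is separated from [tau2] with order at most [N], and
     agreement carries this over to [tau1]; otherwise [tau1] itself is so separated from it. Both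
     contradict the choice of the end. *)
  destruct (endo_total r A B R SA) as [E|E]; [eapply ord_fin; eauto| |].
  - destruct (HN k2 tau2 r A B) as (C & D & OC & HC & EC); auto.
    destruct (tangle_total k1 tau1 C D N) as [X|X]; auto.
    + eapply endo_sep; eauto.
    + apply okn_le with n; auto; lia.
    + apply (tangle_excl k2 tau2 C D); auto. apply (Agree C D N); auto. lia.
    + apply Far. exists D, C; auto using ord_sym.
  - destruct (HN k1 tau1 r B A) as (C & D & OC & HC & EC); auto.
    apply Far. exists D, C; auto using ord_sym.
Qed.

End Graph.

Theorem theorem3 (V : Type) (adj : V -> V -> Prop) :
  simple_graph adj ->
  accessible adj -> locally_finite adj -> quasi_transitive adj ->
  tangle_accessible adj.
Proof.
  intros [adj_sym _] Hacc Hlf Hqt. apply tangles_accessible; auto.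
Qed.
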